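(* Assume the Riemann Hypothesis for $\zeta(s)$. Let $c>1$ and let $k\ge6$ be an even integer. Define, for $y\ge0$, \[ \mathcal{M}^k_c(y):=\Big(\int_1^c\mathcal{M}_k\big(\tfrac yu\big)u^2\frac{du}{u}\Big)\Big/\Big(\int_1^c u^2\frac{du}{u}\Big). \] Then $\mathcal{M}^k_c$ is continuous on $(0,\infty)$, $\mathcal{M}^k_c(0)=0$, and as $y\to\infty$, $\mathcal{M}^k_c(y)=\frac12+o_k(1)$.
   Context: For $y>0$, \[\mathcal{M}_k(y)=\frac{\alpha(-1)^{k/2-1}}{k-1}\sum_{1\le r\le 2\sqrt y}\nu(r)\sqrt{4y-r^2}\,U_{k-2}\Big(\frac{r}{2\sqrt y}\Big)+\frac{\beta}{k-1}\sqrt y-\gamma\,\delta_{k=2}\,y,\] and $\mathcal{M}_k(0)=0$, where $U_n(\cos\theta)=\sin((n+1)\theta)/\sin\theta$ is the Chebyshev polynomial, $\delta_{k=2}$ is $1$ if $k=2$ and $0$ otherwise, $\alpha=2\pi\prod_p\frac{1-p-2p^2+p^4}{p^4-2p^2+p}$, $\beta=2\pi\prod_p\frac{-1+p^2+p^3}{p(-1+p+p^2)}$, $\gamma=12\prod_p\frac{p(1+p)}{-1+p+p^2}$ (products over all primes), and $\nu(r)=\prod_{p\mid r}\big(1+\frac{p^2}{p^4-2p^2-p+1}\big)$. *)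

(* Defs.v *)
From Stdlib Require Import Reals Lra.
From mathcomp Require Import all_boot.
From Coquelicot Require Import Coquelicot.

Set Implicit Arguments.
Unset Strict Implicit.
Unset Printing Implicit Defensive.

Open Scope R_scope.

(* [n_pow_opp n s] is n^(-s) = exp (- s * ln n), for n >= 1. *)
Definition n_pow_opp (n : nat) (s : C) : C :=
  Cmult (RtoC (exp (- Re s * ln (INR n))))
        (cos (Im s * ln (INR n)), - sin (Im s * ln (INR n))).

(* The Riemann zeta function, as the analytic continuation to C \ {1} of its
   Dirichlet series. It is unique away from s = 1, where no value is imposed. *)
Definition is_riemann_zeta (zeta : C -> C) : Prop :=
  (forall s : C, 1 < Re s ->
     @is_series C_AbsRing C_NormedModule (fun n => n_pow_opp n.+1 s) (zeta s))
  /\ (forall s : C, s <> RtoC 1 -> @ex_derive C_AbsRing C_NormedModule zeta s).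

Definition trivial_zero (s : C) : Prop :=
  exists n : nat, (0 < n)%N /\ s = RtoC (- 2 * INR n).

Definition RiemannHypothesis : Prop :=
  forall zeta : C -> C, is_riemann_zeta zeta ->
  forall s : C, s <> RtoC 1 -> zeta s = RtoC 0 -> ~ trivial_zero s ->
  Re s = 1 / 2.

Definition euler_product (f : nat -> R) : R :=
  real (Lim_seq (fun N => \big[Rmult/1]_(0 <= p < N | prime p) f p)).

Definition alpha : R :=
  2 * PI * euler_product (fun n => let p := INR n in
    (1 - p - 2 * p ^ 2 + p ^ 4) / (p ^ 4 - 2 * p ^ 2 + p)).

Definition beta : R :=
  2 * PI * euler_product (fun n => let p := INR n in
    (- 1 + p ^ 2 + p ^ 3) / (p * (- 1 + p + p ^ 2))).

Definition gamma : R :=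
  12 * euler_product (fun n => let p := INR n in
    p * (1 + p) / (- 1 + p + p ^ 2)).

Definition nu (r : nat) : R :=
  \big[Rmult/1]_(q <- primes r)
    (let p := INR q in 1 + p ^ 2 / (p ^ 4 - 2 * p ^ 2 - p + 1)).

Fixpoint chebyshevU (n : nat) (x : R) : R :=
  match n with
  | 0%N => 1
  | n1.+1 => match n1 with
             | 0%N => 2 * x
             | n2.+1 => 2 * x * chebyshevU n1 x - chebyshevU n2 x
             end
  end.

Lemma chebyshevU_cos (n : nat) (t : R) : sin t <> 0 ->
  chebyshevU n (cos t) = sin ((INR n + 1) * t) / sin t.
Proof.
move=> st.
suff H m : chebyshevU m (cos t) = sin ((INR m + 1) * t) / sin t /\
  chebyshevU m.+1 (cos t) = sin ((INR m.+1 + 1) * t) / sin t by case: (H n).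
elim: m => [|m [IH0 IH1]].
  split; rewrite /= ?Rplus_0_l ?Rmult_1_l; first by field.
  by rewrite (_ : (1 + 1) * t = 2 * t); [rewrite sin_2a; field | ring].
split=> //.
have -> : chebyshevU m.+2 (cos t)
  = 2 * cos t * chebyshevU m.+1 (cos t) - chebyshevU m (cos t) by [].
rewrite IH0 IH1 !S_INR.
set a := (INR m + 1 + 1) * t.
rewrite (_ : (INR m + 1) * t = a - t); last by rewrite /a; ring.
rewrite (_ : (INR m + 1 + 1 + 1) * t = a + t); last by rewrite /a; ring.
by rewrite sin_plus sin_minus; field.
Qed.

(* The index r runs over 1 <= r <= floor (2 sqrt y). *)
Definition calM (k : nat) (y : R) : R :=
  if Rlt_dec 0 y then
    alpha * (- 1) ^ (k./2 - 1)%N / (INR k - 1) *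
      (\big[Rplus/0]_(1 <= r < (Z.to_nat (Int_part (2 * sqrt y))).+1)
         (nu r * sqrt (4 * y - INR r ^ 2) *
          chebyshevU (k - 2)%N (INR r / (2 * sqrt y))))
    + beta / (INR k - 1) * sqrt y
    - gamma * (if k == 2%N then 1 else 0) * y
  else 0.

Definition calM_avg (c : R) (k : nat) (y : R) : R :=
  RInt (fun u => calM k (y / u) * u ^ 2 / u) 1 c / RInt (fun u => u ^ 2 / u) 1 c.

(* Main.v *)
(** Write [k = 2j + 2], [n = 2j + 1] and [Z = 2 sqrt y]. Substituting
    [r = Z cos t] turns the summand of [calM] into [nu r * Z * sin (n t)], so that
    [calM y = alpha (-1)^j Z K'(Z)] with
    [K Z = sum_r nu r * r * kker (Z / r) + G (-1)^j / n * Z / 2],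
    [G = prod_p (1 + g p) = beta / alpha], [1 + g p] being the local factor of [nu].
    Integrating by parts in [u], the average of [calM] is an integral of differences
    [K (lam Z) - K Z], and everything reduces to
    [K (lam Z) - K Z --> A (-1)^j (PI / 24) ln lam], where
    [A = prod_p (1 + p g p) (1 - 1/p)] and [alpha A = 2 PI / zeta 2 = 12 / PI].

    If [nu] is replaced by [r |-> sum_(d | r) d^-2], then [K Z] is
    [sum_d kappa (Z / d) / d] where [kappa N] integrates the trigonometric
    polynomial [cos (n t) / cos t] against a periodic quadratic function of
    [N cos t]. Integration by parts gives [kappa N = (-1)^j PI / 24 + O(N^(-1/2))],
    whence the logarithmic growth with slope [(-1)^j PI / 24].
    The function [nu] is reached from [sum_(d | r) d^-2] by correcting one prime [p]
    at a time; on [K] this correction is [1 + (p g p - 1/p) S_p - g p S_p^2], with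
    [S_p K (Z) = K (Z / p)], and its coefficients are [O(p^-2)], so the corrections
    converge uniformly. *)

Require Import Defs.
From HB Require Import structures.
From Stdlib Require Import Reals Lra Lia ZArith.
From mathcomp Require Import all_boot zify.
From Coquelicot Require Import Coquelicot.
Open Scope R_scope.

(** * The kernel *)

(** Before its periodic part, the sum of [kker] over [r] has a quadratic and a linear term in [Z].
    The quadratic one vanishes because [cos (n t)] is orthogonal to [cos t] for [n > 1]; the linear
    one is governed by the sum of the divisor coefficients of the weight and is exactly cancelled by
    the [beta] term. Only logarithmic growth remains. The weight [d^-2] is a good model because the
    resulting coefficients [1 / d] are smooth in [d], so that a sum over [d] can be compared with an
    integral, and because they agree with [p g p] to leading order at primes. In terms of dilations
    the model is the product of [(1 - S_p / p)^-1] and [nu] that of [1 + p g p S_p], so the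
    correction at [p] is [(1 + p g p S_p) (1 - S_p / p)]. On the slope of a logarithm [S_p] acts as
    [1], whence the local factor of [A]. As [K] is unbounded, only its differences under bounded
    dilations are controlled. Their bounds must hold for every [Z > 0] and uniformly in the number
    of corrected primes, since a correction evaluates [K] at [Z / p] and [Z / p^2]. *)

Lemma continuous_ex_derive (f : R -> R) (x : R) : ex_derive f x -> continuous f x.
Proof. exact: ex_derive_continuous. Qed.

Lemma is_RInt_antiderivative (F f : R -> R) (a b : R) :
  (forall x, is_derive F x (f x)) -> (forall x, continuous f x) ->
  is_RInt f a b (F b - F a).
Proof. by move=> dF cf; apply: is_RInt_derive. Qed.

(* Coquelicot's lemmas leave equalities typed in the carrier of a module,
   which [ring] and [field] do not recognise as [R]. *)
Ltac eqR := match goal with |- @eq _ ?a ?b => change (@eq R a b) end.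

(* [qker j t = cos ((2 j + 1) t) / cos t], without a pole at [PI / 2]. *)
Fixpoint qker (j : nat) (t : R) : R :=
  if j is i.+1 then 2 * cos (2 * (INR i + 1) * t) - qker i t else 1.

Fixpoint Qker (j : nat) (t : R) : R :=
  if j is i.+1 then sin (2 * (INR i + 1) * t) / (INR i + 1) - Qker i t else t.

Fixpoint dqker (j : nat) (t : R) : R :=
  if j is i.+1 then - (4 * (INR i + 1) * sin (2 * (INR i + 1) * t)) - dqker i t
  else 0.

Lemma qker_cos (j : nat) (t : R) :
  qker j t * cos t = cos ((2 * INR j + 1) * t).
Proof.
elim: j => [|j IH]; first by rewrite /= Rmult_1_l; congr cos; ring.
rewrite [qker _ _]/= Rmult_minus_distr_r IH S_INR.
set a := 2 * (INR j + 1) * t.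
have -> : (2 * INR j + 1) * t = a - t by rewrite /a; ring.
have -> : (2 * (INR j + 1) + 1) * t = a + t by rewrite /a; ring.
by rewrite cos_plus cos_minus; ring.
Qed.

Lemma is_derive_Qker (j : nat) (t : R) : is_derive (Qker j) t (qker j t).
Proof.
elim: j => [|j IH]; first exact: is_derive_id.
apply: (is_derive_ext (fun t => sin (2 * (INR j + 1) * t) / (INR j + 1) - Qker j t)) => //.
have ? := pos_INR j.
apply: is_derive_minus => //=; auto_derive => //; field; lra.
Qed.

Lemma is_derive_qker (j : nat) (t : R) : is_derive (qker j) t (dqker j t).
Proof.
elim: j => [|j IH]; first exact: is_derive_const.
apply: (is_derive_ext (fun t => 2 * cos (2 * (INR j + 1) * t) - qker j t)) => //.
by apply: is_derive_minus => //=; auto_derive => //; ring.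
Qed.

Lemma continuous_qker (j : nat) (t : R) : continuous (qker j) t.
Proof. by apply: continuous_ex_derive; exists (dqker j t); apply: is_derive_qker. Qed.

Lemma continuous_dqker (j : nat) (t : R) : continuous (dqker j) t.
Proof.
elim: j => [|j IH]; first exact: continuous_const.
apply: (continuous_minus (fun t => - (4 * (INR j + 1) * sin (2 * (INR j + 1) * t)))) => //.
by apply: continuous_ex_derive; auto_derive.
Qed.

Lemma qker_bound (j : nat) : exists C, 0 < C /\
  forall t, Rabs (qker j t) <= C /\ Rabs (dqker j t) <= C.
Proof.
elim: j => [|j [C [C0 IH]]].
  by exists 1; split; [lra|move=> t /=; rewrite Rabs_R1 Rabs_R0; lra].
have j0 := pos_INR j.
exists (C + 4 * (INR j + 1) + 2); split; first lra.
move=> t; have [H1 H2] := IH t; rewrite [qker _ _]/= [dqker _ _]/=.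
have := COS_bound (2 * (INR j + 1) * t); have := SIN_bound (2 * (INR j + 1) * t).
set a := cos _; set b := sin _ => Hb Ha.
move: H1 H2 => /Rabs_le_between H1 /Rabs_le_between H2.
by split; apply/Rabs_le_between; nra.
Qed.

Lemma Qker0 (j : nat) : Qker j 0 = 0.
Proof. by elim: j => //= j ->; rewrite Rmult_0_r sin_0; lra. Qed.

Lemma sin_nat_PI (n : nat) : sin (INR n * PI) = 0.
Proof. by apply: sin_eq_0_1; exists (Z.of_nat n); rewrite -INR_IZR_INZ. Qed.

(** This is the integral of [cos (n t) / cos t] over a quarter period; each recursion step flips its
    sign because the new sine vanishes at [PI / 2]. Multiplied by [1 / 12], the mean of [hper], it
    becomes the limit of [kappa]. *)
Lemma Qker_PI2 (j : nat) : Qker j (PI / 2) = (- 1) ^ j * (PI / 2).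
Proof.
elim: j => [|j IH]; first by rewrite /=; ring.
rewrite [LHS]/= IH.
have -> : 2 * (INR j + 1) * (PI / 2) = INR j.+1 * PI by rewrite S_INR; field.
by rewrite sin_nat_PI /=; have ? := pos_INR j; field; lra.
Qed.

Lemma sin_odd_PI2 (j : nat) : sin ((2 * INR j + 1) * (PI / 2)) = (- 1) ^ j.
Proof.
elim: j => [|j IH]; first by rewrite /= Rmult_0_r Rplus_0_l Rmult_1_l sin_PI2.
rewrite S_INR (_ : _ * _ = (2 * INR j + 1) * (PI / 2) + PI); last by field.
by rewrite neg_sin IH /=; ring.
Qed.

Lemma is_RInt_qker (j : nat) (a b : R) : is_RInt (qker j) a b (Qker j b - Qker j a).
Proof.
by apply: is_RInt_antiderivative => x; [apply: is_derive_Qker|apply: continuous_qker].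
Qed.

Lemma is_RInt_qker_cos (j : nat) (x : R) :
  is_RInt (fun t => qker j t * cos t) 0 x
    (sin ((2 * INR j + 1) * x) / (2 * INR j + 1)).
Proof.
have ? := pos_INR j.
apply: (is_RInt_ext (fun t => cos ((2 * INR j + 1) * t))) => [t _|].
  by rewrite qker_cos.
have -> : sin ((2 * INR j + 1) * x) / (2 * INR j + 1) =
  sin ((2 * INR j + 1) * x) / (2 * INR j + 1)
  - sin ((2 * INR j + 1) * 0) / (2 * INR j + 1).
  by rewrite Rmult_0_r sin_0; field; lra.
apply: (is_RInt_antiderivative (fun x => sin ((2 * INR j + 1) * x) / (2 * INR j + 1))) => t.
  by auto_derive => //; field; lra.
by apply: continuous_ex_derive; auto_derive.
Qed.

(** Orthogonality of [cos (n t)] and [cos t], which removes the quadratic term of [sum_pos_part].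
    For [j = 0] the cosine of [2 * INR j * t] would be constant and the integral nonzero. *)
Lemma is_RInt_qker_cos2 (j : nat) : (0 < j)%N ->
  is_RInt (fun t => qker j t * cos t ^ 2) 0 (PI / 2) 0.
Proof.
move=> j0; have Hj : 0 < INR j by apply: lt_0_INR; lia.
apply: (is_RInt_ext (fun t => (cos (2 * INR j * t) + cos (2 * (INR j + 1) * t)) / 2)).
  move=> t _.
  rewrite (_ : qker j t * cos t ^ 2 = (qker j t * cos t) * cos t); last by ring.
  rewrite qker_cos; set a := (2 * INR j + 1) * t.
  rewrite (_ : 2 * INR j * t = a - t); last by rewrite /a; ring.
  rewrite (_ : 2 * (INR j + 1) * t = a + t); last by rewrite /a; ring.
  by rewrite cos_plus cos_minus; eqR; field.
pose F t := sin (2 * INR j * t) / (4 * INR j) + sin (2 * (INR j + 1) * t) / (4 * (INR j + 1)).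
have E : F (PI / 2) - F 0 = 0.
  rewrite /F !Rmult_0_r sin_0.
  have -> : 2 * INR j * (PI / 2) = INR j * PI by field.
  have -> : 2 * (INR j + 1) * (PI / 2) = INR j.+1 * PI by rewrite S_INR; field.
  by rewrite !sin_nat_PI; field; lra.
rewrite -[X in is_RInt _ _ _ X]E; apply: (is_RInt_antiderivative F) => t.
  by rewrite /F; auto_derive => //; field; lra.
by apply: continuous_ex_derive; auto_derive.
Qed.

(* [phi z] is the angle with cosine [1 / z]; since [sqrt] vanishes on negative
   numbers, it is [0] for [0 <= z <= 1]. *)
Definition phi (z : R) : R := atan (sqrt (z ^ 2 - 1)).

Lemma phi_le1 (z : R) : 0 <= z <= 1 -> phi z = 0.
Proof. by move=> z1; rewrite /phi sqrt_neg_0 ?atan_0 //; nra. Qed.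

Lemma phi_bound (z : R) : 0 <= phi z <= PI / 2.
Proof.
have [_ H] := atan_bound (sqrt (z ^ 2 - 1)); rewrite /phi; split; last lra.
have [Hs|<-] := sqrt_pos (z ^ 2 - 1); last by rewrite atan_0; lra.
by left; rewrite -[X in X < _]atan_0; apply: atan_increasing.
Qed.

Lemma cos_phi (z : R) : 1 <= z -> cos (phi z) = / z.
Proof.
move=> z1; rewrite cos_atan Rsqr_sqrt; last nra.
by rewrite (_ : 1 + _ = z ^ 2); [rewrite sqrt_pow2; [field|]; lra|ring].
Qed.

Lemma sin_phi (z : R) : 1 <= z -> sin (phi z) = sqrt (z ^ 2 - 1) / z.
Proof.
move=> z1; rewrite sin_atan Rsqr_sqrt; last nra.
by rewrite (_ : 1 + _ = z ^ 2); [rewrite sqrt_pow2 //; lra|ring].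
Qed.

Lemma continuous_phi (z : R) : continuous phi z.
Proof.
apply: continuous_atan_comp; apply: (continuous_comp (fun z => z ^ 2 - 1)).
  by apply: continuous_ex_derive; auto_derive.
exact: continuous_sqrt.
Qed.

(** This is a primitive of [dkker] on the positive axis. It is also the integral of
    [qker j t * Rmax 0 (z * cos t - 1)], a form in which the sum over [r] can be carried out under
    the integral. *)
Definition kker (j : nat) (z : R) : R :=
  z * sin ((2 * INR j + 1) * phi z) / (2 * INR j + 1) - Qker j (phi z).

Definition dkker (j : nat) (z : R) : R :=
  sin ((2 * INR j + 1) * phi z) / (2 * INR j + 1).

Lemma kker_le1 (j : nat) (z : R) : 0 <= z <= 1 -> kker j z = 0.
Proof.
move=> z1; rewrite /kker phi_le1 // Rmult_0_r sin_0 Qker0.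
by have ? := pos_INR j; field; lra.
Qed.

Lemma dkker_le1 (j : nat) (z : R) : 0 <= z <= 1 -> dkker j z = 0.
Proof.
move=> z1; rewrite /dkker phi_le1 // Rmult_0_r sin_0.
by have ? := pos_INR j; field; lra.
Qed.

Lemma continuous_dkker (j : nat) (z : R) : continuous (dkker j) z.
Proof.
apply: (continuous_mult (fun z => sin _)); last exact: continuous_const.
apply: continuous_sin_comp; apply: (continuous_mult (fun=> _)).
  exact: continuous_const.
exact: continuous_phi.
Qed.

Lemma continuous_kker (j : nat) (z : R) : continuous (kker j) z.
Proof.
apply: (continuous_ext (fun z => z * dkker j z - Qker j (phi z))) => [x|].
  by rewrite /kker /dkker /Rdiv Rmult_assoc.
apply: (continuous_minus (fun z => z * dkker j z)).
  by apply: (continuous_mult id); [apply: continuous_id|apply: continuous_dkker].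
apply: (continuous_comp phi); first exact: continuous_phi.
by apply: continuous_ex_derive; exists (qker j (phi z)); apply: is_derive_Qker.
Qed.

(* The derivative of [phi] drops out, because [z * cos (n phi) = qker j phi]. *)
Lemma is_derive_kker_gt1 (j : nat) (z : R) : 1 < z -> is_derive (kker j) z (dkker j z).
Proof.
move=> z1; have ? := pos_INR j.
have s0 : 0 < sqrt (z ^ 2 - 1) by apply: sqrt_lt_R0; nra.
have Hphi : is_derive phi z (/ (z * sqrt (z ^ 2 - 1))).
  rewrite /phi; auto_derive; first nra.
  have -> : z * (z * 1) + - (1) = z ^ 2 - 1 by ring.
  rewrite [X in / (1 + X)](_ : _ = sqrt (z ^ 2 - 1) * sqrt (z ^ 2 - 1)); last by ring.
  by rewrite sqrt_sqrt; [field|]; nra.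
have HQ : is_derive (fun z => Qker j (phi z)) z
    (/ (z * sqrt (z ^ 2 - 1)) * qker j (phi z)).
  by apply: (is_derive_comp (Qker j) phi) => //; apply: is_derive_Qker.
have HS : is_derive (fun z => z * sin ((2 * INR j + 1) * phi z) / (2 * INR j + 1)) z
   (dkker j z + z * cos ((2 * INR j + 1) * phi z) * / (z * sqrt (z ^ 2 - 1))).
  auto_derive; first by exists (/ (z * sqrt (z ^ 2 - 1))).
  rewrite (is_derive_unique (fun x => phi x) _ _ Hphi) /dkker; field; lra.
move: s0 HS HQ {Hphi}; set w := sqrt _ => w0 HS HQ.
have := is_derive_minus _ _ _ _ _ HS HQ.
set d := minus _ _; suff -> : d = dkker j z by [].
rewrite /d /minus /plus /opp /= -qker_cos cos_phi; last lra.
by eqR; field; lra.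
Qed.

Lemma is_derive_kker (j : nat) (z : R) : 0 < z -> is_derive (kker j) z (dkker j z).
Proof.
move=> z0.
have lt1 x : 0 < x < 1 -> is_derive (kker j) x (dkker j x).
  move=> x1; rewrite dkker_le1; last lra.
  apply: (is_derive_ext_loc (fun=> 0)); last exact: is_derive_const.
  apply: (locally_interval _ x 0 1) => /=; try lra.
  by move=> y y0 y1; rewrite kker_le1 //; lra.
case: (Rtotal_order z 1) => [zl|[->|zg]]; [by apply: lt1|  | exact: is_derive_kker_gt1].
(* At [z = 1] the angle [phi] has no derivative. The mean value theorem on either side, together
   with the continuity of [dkker], supplies that of [kker]. *)
apply/is_derive_Reals => eps eps0.
have := continuous_dkker j 1; move/(_ _ (locally_ball (dkker j 1) (mkposreal _ eps0))).
case=> [[d d0] Hd]; rewrite /= in Hd.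
have d' : 0 < Rmin d 1 by apply: Rmin_pos; lra.
exists (mkposreal _ d') => h h0 /= hd.
have hd1 : Rabs h < d by have := Rmin_l d 1; lra.
have hd2 : Rabs h < 1 by have := Rmin_r d 1; lra.
move/Rabs_lt_between: hd2 => hd2.
have [|x _|c [cb ->]] := MVT_gen (kker j) 1 (1 + h) (dkker j).
- move=> x; rewrite /Rmin /Rmax; case: Rle_dec => ? xb.
    by apply: is_derive_kker_gt1; lra.
  by apply: lt1; lra.
- exact/continuity_pt_filterlim/continuous_kker.
rewrite (_ : dkker j c * (1 + h - 1) / h = dkker j c); last by field.
apply: Hd; rewrite /ball /= /AbsRing_ball /= /abs /minus /plus /opp /=.
move: cb hd1; rewrite /Rmin /Rmax /Rabs; case: Rle_dec; case: Rcase_abs; case: Rcase_abs; lra.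
Qed.

(** The integrand lives on [[0, phi (N / m)]], where [N * cos t >= m]. There it is [N] times
    [cos (n t)] minus [m] times [qker], both with known primitives. *)
Lemma is_RInt_qker_pos_part (j : nat) (N m : R) : 0 < N -> 0 < m ->
  is_RInt (fun t => qker j t * Rmax 0 (N * cos t - m)) 0 (PI / 2) (m * kker j (N / m)).
Proof.
move=> N0 m0; have ? := pos_INR j; have pi0 := PI_RGT_0.
have zero a b : 0 <= a -> a <= b -> b <= PI / 2 -> N * cos a <= m ->
    is_RInt (fun t => qker j t * Rmax 0 (N * cos t - m)) a b 0.
  move=> a0 ab bpi Na.
  apply: (is_RInt_ext (fun=> 0)) => [t|].
    rewrite Rmin_left // Rmax_right // => tab.
    have ? : cos t <= cos a by apply: cos_decr_1; lra.
    by rewrite Rmax_left ?Rmult_0_r //; nra.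
  have := is_RInt_const a b (0 : R); rewrite /scal /= /mult /= Rmult_0_r.
  by [].
have [Nm|Nm] := Rle_lt_dec N m.
  rewrite kker_le1 ?Rmult_0_r; last first.
    split; first by apply: Rdiv_le_0_compat; lra.
    by apply/Rle_div_l; lra.
  by apply: zero; rewrite ?cos_0; lra.
have z1 : 1 <= N / m by apply/Rle_div_r; lra.
have Nz : N = m * (N / m) by field; lra.
move: z1 Nz; set z := N / m; move: z => z z1 Nz; have [p0 p1] := phi_bound z.
rewrite -(Rplus_0_r (m * _)); apply: (is_RInt_Chasles _ _ (phi z)); last first.
  apply: zero; try lra.
  by rewrite cos_phi //; right; rewrite Nz; field; lra.
apply: (is_RInt_ext (fun t => minus (scal N (qker j t * cos t)) (scal m (qker j t)))).
  move=> t; rewrite Rmin_left // Rmax_right // => tab.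
  rewrite Rmax_right; first by rewrite /minus /plus /opp /scal /= /mult /=; ring.
  have : cos (phi z) <= cos t by apply: cos_decr_1; lra.
  rewrite cos_phi // => H.
  suff : m <= N * cos t by lra.
  apply: Rle_trans (Rmult_le_compat_l N _ _ _ H); last lra.
  by right; rewrite Nz; field; lra.
have := is_RInt_minus _ _ _ _ _ _
  (is_RInt_scal _ _ _ N _ (is_RInt_qker_cos j (phi z)))
  (is_RInt_scal _ _ _ m _ (is_RInt_qker j 0 (phi z))).
rewrite Qker0 /kker; set A := minus _ _; set B := m * _; suff -> : A = B by [].
by rewrite /A /B /minus /plus /opp /scal /= /mult /= Nz; field; lra.
Qed.

(** * The periodic function and the integrals [kappa] *)

HB.instance Definition _ := Monoid.isComLaw.Build R 0 Rplus
  (fun x y z => esym (Rplus_assoc x y z)) Rplus_comm Rplus_0_l.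
HB.instance Definition _ := Monoid.isComLaw.Build R 1 Rmult
  (fun x y z => esym (Rmult_assoc x y z)) Rmult_comm Rmult_1_l.
HB.instance Definition _ := Monoid.isMulLaw.Build R 0 Rmult Rmult_0_l Rmult_0_r.
HB.instance Definition _ := Monoid.isAddLaw.Build R Rmult Rplus
  Rmult_plus_distr_r (fun x y z => Rmult_plus_distr_l x y z).

Lemma is_RInt_bigsum (F : nat -> R -> R) (l : nat -> R) (a b : R) (n : nat) :
  (forall i, (0 < i)%N -> is_RInt (F i) a b (l i)) ->
  is_RInt (fun t => \big[Rplus/0]_(1 <= i < n.+1) F i t) a b
    (\big[Rplus/0]_(1 <= i < n.+1) l i).
Proof.
move=> H; elim: n => [|n IH].
  rewrite big_geq //; apply: (is_RInt_ext (fun=> 0)) => [t _|].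
    by rewrite big_geq.
  have := is_RInt_const a b (0 : R); rewrite /scal /= /mult /= Rmult_0_r.
  by [].
rewrite big_nat_recr //=; apply: (is_RInt_ext
  (fun t => plus (\big[Rplus/0]_(1 <= i < n.+1) F i t) (F n.+1 t))) => [t _|].
  by rewrite [RHS]big_nat_recr.
by apply: is_RInt_plus => //; apply: H.
Qed.

(* [1 / 12 - hper] is half the periodic second Bernoulli polynomial. *)
Definition hper (t : R) : R := frac_part t * (1 - frac_part t) / 2.

Lemma frac_partE (i : Z) (t : R) : IZR i <= t < IZR i + 1 -> frac_part t = t - IZR i.
Proof. by move=> H; rewrite /frac_part -(Int_part_spec t i) //; lra. Qed.

Lemma hperE (i : Z) (t : R) : IZR i <= t <= IZR i + 1 ->
  hper t = (t - IZR i) * (IZR i + 1 - t) / 2.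
Proof.
move=> H; have [ti|ti] := Rle_lt_dec (IZR i + 1) t.
  rewrite /hper (frac_partE (i + 1)) plus_IZR; last lra.
  have -> : t = IZR i + 1 by lra.
  by field.
by rewrite /hper (frac_partE i); [field|lra].
Qed.

Lemma floor_ex (t : R) : exists i : Z, IZR i <= t < IZR i + 1.
Proof. by exists (Int_part t); have := base_Int_part t; lra. Qed.

Lemma hper_add1 (t : R) : hper (t + 1) = hper t.
Proof.
have [i Hi] := floor_ex t.
by rewrite (hperE i t) ?(hperE (i + 1) (t + 1)) ?plus_IZR; lra.
Qed.

Lemma hper_bound (t : R) : 0 <= hper t <= 1 / 8.
Proof.
by have := base_fp t; rewrite /hper; have := pow2_ge_0 (frac_part t - 1 / 2); nra.
Qed.

Lemma hper_lipschitz (s t : R) : Rabs (hper s - hper t) <= Rabs (s - t) / 2.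
Proof.
wlog st : s t / s <= t => [H|].
  have [st|ts] := Rle_lt_dec s t; first exact: H.
  by rewrite Rabs_minus_sym (Rabs_minus_sym s); apply: H; lra.
rewrite (Rabs_left1 (s - t)); last lra.
have [i Hi] := floor_ex s; have [k Hk] := floor_ex t.
rewrite (hperE i s) ?(hperE k t); try lra.
have [ik|] := Z.lt_ge_cases i k.
  have {}ik : IZR i + 1 <= IZR k by rewrite -plus_IZR; apply: IZR_le; lia.
  by apply/Rabs_le_between; nra.
move=> ki; have {ki}E : i = k.
  have : (i < k + 1)%Z by apply: lt_IZR; rewrite plus_IZR; lra.
  lia.
subst k.
rewrite (_ : _ - _ = (s - t) * (1 - (s - IZR i) - (t - IZR i)) / 2); last by field.
by apply/Rabs_le_between; split; nra.
Qed.

Lemma continuous_hper (t : R) : continuous hper t.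
Proof.
apply/continuity_pt_filterlim => eps eps0; exists eps; split=> // s [_] /=.
rewrite /R_dist => H; apply: Rle_lt_trans (hper_lipschitz s t) _.
by have := Rabs_pos (s - t); lra.
Qed.

Lemma hper0 : hper 0 = 0.
Proof. by rewrite (hperE 0); lra. Qed.

(** With [n] the integer part and [f] the fractional part of [t], the sum is [n t - n (n + 1) / 2];
    putting [n = t - f] leaves [f (1 - f) / 2] beside the polynomial. *)
Lemma sum_pos_part (M : nat) (t : R) : 0 <= t <= INR M ->
  \big[Rplus/0]_(1 <= m < M.+1) Rmax 0 (t - INR m) = t ^ 2 / 2 - t / 2 + hper t.
Proof.
elim: M t => [|M IH] t.
  by rewrite [INR 0]/= => t0; rewrite big_geq // (_ : t = 0) ?hper0; lra.
rewrite S_INR => tM.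
have [t1|t1] := Rlt_le_dec t 1.
  rewrite big_nat big1 => [|m mM]; first by rewrite (hperE 0); lra.
  rewrite Rmax_left //; have : 1 <= INR m by apply: (le_INR 1); lia.
  lra.
rewrite big_nat_recl // [INR 1]/= -[in hper t](Rplus_0_r t).
rewrite (_ : t + 0 = (t - 1) + 1); last by ring.
rewrite hper_add1 Rmax_right; last lra.
rewrite (eq_bigr (fun m => Rmax 0 (t - 1 - INR m))) => [|m _]; last first.
  by rewrite S_INR; congr Rmax; ring.
rewrite IH; last lra.
by field.
Qed.

Definition hint (t : R) : R := RInt (fun s => hper s - 1 / 12) 0 t.

Lemma continuous_hper_sub (t : R) : continuous (fun s => hper s - 1 / 12) t.
Proof.
by apply: (continuous_minus hper); [apply: continuous_hper|apply: continuous_const].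
Qed.

Lemma ex_RInt_hper_sub (a b : R) : ex_RInt (fun s => hper s - 1 / 12) a b.
Proof. by apply: ex_RInt_continuous => t _; apply: continuous_hper_sub. Qed.

Lemma is_derive_hint (t : R) : is_derive hint t (hper t - 1 / 12).
Proof.
apply: (is_derive_RInt (fun s => hper s - 1 / 12) _ 0); last exact: continuous_hper_sub.
by apply: filter_forall => b; apply: RInt_correct; apply: ex_RInt_hper_sub.
Qed.

(** Since [1 / 12] is the mean of [hper] over a period, the centred primitive returns to [0] at
    every integer, and is therefore bounded. *)
Lemma hint_nat (n : nat) : hint (INR n) = 0.
Proof.
elim: n => [|n IH]; first by rewrite /hint RInt_point.
rewrite /hint -(RInt_Chasles _ 0 (INR n)); try exact: ex_RInt_hper_sub.
rewrite -/(hint (INR n)) IH plus_zero_l; apply: is_RInt_unique.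
pose x := INR n.
pose F t := (t - x) ^ 2 / 4 - (t - x) ^ 3 / 6 - (t - x) / 12.
have E : F (INR n.+1) - F x = 0 by rewrite /F S_INR -/x; field.
rewrite -[X in is_RInt _ _ _ X]E.
apply: (is_RInt_ext (fun t => (t - x) * (x + 1 - t) / 2 - 1 / 12)).
  move=> t; rewrite S_INR -/x Rmin_left ?Rmax_right; try lra; move=> H.
  by rewrite (hperE (Z.of_nat n)) -INR_IZR_INZ //; rewrite -/x; lra.
apply: (is_RInt_antiderivative F) => t; first by rewrite /F; auto_derive => //; field.
by apply: continuous_ex_derive; auto_derive.
Qed.

Lemma hint_bound (t : R) : 0 <= t -> Rabs (hint t) <= 1.
Proof.
move=> t0; have [i Hi] := floor_ex t.
have [n Hn] : exists n, IZR i = INR n.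
  exists (Z.to_nat i); rewrite INR_IZR_INZ Z2Nat.id //.
  have : (-1 < i)%Z by apply: lt_IZR; lra.
  lia.
rewrite Hn in Hi.
rewrite /hint -(RInt_Chasles _ 0 (INR n)); try exact: ex_RInt_hper_sub.
rewrite -/(hint (INR n)) hint_nat plus_zero_l.
apply: Rle_trans (_ : (t - INR n) * 1 <= 1); last lra.
apply: abs_RInt_le_const; [lra|exact: ex_RInt_hper_sub|move=> s _].
by have := hper_bound s => H; apply/Rabs_le_between; lra.
Qed.

Definition kappa (j : nat) (N : R) : R :=
  RInt (fun t => qker j t * hper (N * cos t)) 0 (PI / 2).

Lemma continuous_kappa_fun (j : nat) (N t : R) :
  continuous (fun t => qker j t * hper (N * cos t)) t.
Proof.
apply: (continuous_mult (qker j)); first exact: continuous_qker.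
apply: (continuous_comp (fun t => N * cos t)); last exact: continuous_hper.
by apply: continuous_ex_derive; auto_derive.
Qed.

Lemma ex_RInt_kappa (j : nat) (N a b : R) :
  ex_RInt (fun t => qker j t * hper (N * cos t)) a b.
Proof. by apply: ex_RInt_continuous => t _; apply: continuous_kappa_fun. Qed.

(** Sum [is_RInt_qker_pos_part] over [m] and apply [sum_pos_part] with [t] replaced by [N cos t].
    The quadratic term integrates to [0], and the linear one to the opposite of the last term of the
    statement, so only [hper] is left. *)
Lemma kappa_sum (j M : nat) (N : R) : (0 < j)%N -> 0 < N <= INR M ->
  kappa j N = \big[Rplus/0]_(1 <= m < M.+1) (INR m * kker j (N / INR m))
    + (- 1) ^ j / (2 * INR j + 1) * N / 2.
Proof.
move=> j0 NM; apply: is_RInt_unique; have Hj := pos_INR j; have pi0 := PI_RGT_0.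
have I1 := is_RInt_bigsum (fun m t => qker j t * Rmax 0 (N * cos t - INR m))
  (fun m => INR m * kker j (N / INR m)) 0 (PI / 2) M.
have {}I1 := I1 (fun m m0 => is_RInt_qker_pos_part j N (INR m) (proj1 NM)
  (lt_0_INR m (ltP m0))).
have I2 := is_RInt_scal _ _ _ (- N ^ 2 / 2) _ (is_RInt_qker_cos2 j j0).
have I3 := is_RInt_scal _ _ _ (N / 2) _ (is_RInt_qker_cos j (PI / 2)).
have := is_RInt_plus _ _ _ _ _ _ I1 (is_RInt_plus _ _ _ _ _ _ I2 I3).
set S := \big[_/_]_(_ <= _ < _) _.
rewrite (_ : plus _ _ = S + (- 1) ^ j / (2 * INR j + 1) * N / 2); last first.
  rewrite /plus /scal /= /mult /= sin_odd_PI2; eqR; field; lra.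
apply: is_RInt_ext => t; rewrite Rmin_left ?Rmax_right; try lra; move=> tpi.
rewrite -big_distrr /= sum_pos_part.
  by rewrite /plus /scal /= /mult /=; eqR; field.
have c0 : 0 <= cos t by apply: cos_ge_0; lra.
have [_ c1] := COS_bound t.
by split; nra.
Qed.

Lemma kappa_lipschitz (j : nat) : exists C, 0 < C /\
  forall N1 N2, Rabs (kappa j N1 - kappa j N2) <= C * Rabs (N1 - N2).
Proof.
have [C [C0 HC]] := qker_bound j; have pi0 := PI_RGT_0.
exists (PI / 2 * C); split; first nra.
move=> N1 N2.
have -> : kappa j N1 - kappa j N2 = RInt (fun t => minus
    (qker j t * hper (N1 * cos t)) (qker j t * hper (N2 * cos t))) 0 (PI / 2).
  by rewrite RInt_minus //; apply: ex_RInt_kappa.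
apply: Rle_trans (_ : (PI / 2 - 0) * (C * Rabs (N1 - N2)) <= _); last by right; ring.
apply: abs_RInt_le_const; first lra.
  by apply: (ex_RInt_minus (V := R_NormedModule)); apply: ex_RInt_kappa.
move=> t _; rewrite /minus /plus /opp /=.
rewrite (_ : _ + _ = qker j t * (hper (N1 * cos t) - hper (N2 * cos t))); last by ring.
rewrite Rabs_mult; apply: Rmult_le_compat; try exact: Rabs_pos.
  by case: (HC t).
apply: Rle_trans (hper_lipschitz _ _) _.
rewrite -Rmult_minus_distr_r Rabs_mult.
have : Rabs (cos t) <= 1 by apply/Rabs_le_between; apply: COS_bound.
by have := Rabs_pos (N1 - N2); have := Rabs_pos (cos t); nra.
Qed.

Lemma kappa0 (j : nat) : kappa j 0 = 0.
Proof.
apply: is_RInt_unique; apply: (is_RInt_ext (fun=> 0)) => [t _|].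
  by rewrite Rmult_0_l hper0 Rmult_0_r.
by have := is_RInt_const 0 (PI / 2) (0 : R); rewrite /scal /= /mult /= Rmult_0_r.
Qed.

Lemma is_derive_cot (t : R) : sin t <> 0 ->
  is_derive (fun t => - (cos t / sin t)) t (/ sin t ^ 2).
Proof.
move=> s0; auto_derive => //.
have := sin2_cos2 t; rewrite /Rsqr => H.
have -> : / (sin t * (sin t * 1)) = (sin t * sin t + cos t * cos t) / (sin t * sin t).
  by rewrite H; field.
by field.
Qed.

(* Integrate by parts away from the stationary point [t = 0], at distance
   [1 / sqrt N] from it. *)
Lemma kappa_decay (j : nat) : exists C, 0 < C /\
  forall N, 1 <= N -> Rabs (kappa j N - (- 1) ^ j * (PI / 2) / 12) <= C / sqrt N.
Proof.
have [C [C0 HC]] := qker_bound j; have pi3 := PI2_3_2; have pi0 := PI_RGT_0.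
pose g N t := qker j t * (hper (N * cos t) - 1 / 12).
have cg N t : continuous (g N) t.
  apply: (continuous_mult (qker j) (fun t => hper (N * cos t) - 1 / 12)).
    exact: continuous_qker.
  apply: (continuous_comp (fun t => N * cos t) (fun s => hper s - 1 / 12));
    last exact: continuous_hper_sub.
  by apply: continuous_ex_derive; auto_derive.
have exg N a b : ex_RInt (g N) a b by apply: ex_RInt_continuous => t _; apply: cg.
have Eg N : kappa j N - (- 1) ^ j * (PI / 2) / 12 = RInt (g N) 0 (PI / 2).
  have := is_RInt_minus _ _ _ _ _ _ (RInt_correct _ _ _ (ex_RInt_kappa j N 0 (PI / 2)))
    (is_RInt_scal _ _ _ (1 / 12) _ (is_RInt_qker j 0 (PI / 2))).
  rewrite Qker0 Qker_PI2 => H; symmetry; apply: is_RInt_unique.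
  rewrite (_ : _ - _ = minus (RInt (fun t => qker j t * hper (N * cos t)) 0 (PI / 2))
     (scal (1 / 12) ((- 1) ^ j * (PI / 2) - 0))); last first.
    by rewrite /minus /plus /opp /scal /= /mult /= /kappa; eqR; field.
  apply: is_RInt_ext H => t _.
  by rewrite /g /minus /plus /opp /scal /= /mult /=; eqR; field.
(* The range [[0, 1 / sqrt N]] costs [C / sqrt N]. The rest costs [7 * C / sqrt N]: [1] and [2] from
   the boundary terms at [PI / 2] and [d], [4] from the remaining integral. One [C] is slack. *)
exists (9 * C); split; first lra.
move=> N N1; rewrite Eg.
have sN : 0 < sqrt N by apply: sqrt_lt_R0; lra.
have sN1 : 1 <= sqrt N by rewrite -sqrt_1; apply: sqrt_le_1_alt.
have sNN : sqrt N * sqrt N = N by apply: sqrt_sqrt; lra.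
pose d := / sqrt N.
have d0 : 0 < d by apply: Rinv_0_lt_compat.
have d1 : d <= 1 by rewrite /d -Rinv_1; apply: Rinv_le_contravar; lra.
(* As [d <= 1 < PI / 3], the cosine is at least [1 / 2] on [[0, d]]. *)
have sd : d / 2 <= sin d.
  have [x _|x _|x []] := MVT_gen sin 0 d cos; first by auto_derive => //; ring.
    by apply/continuity_pt_filterlim; apply: continuous_sin.
  rewrite Rmin_left ?Rmax_right; try lra; rewrite sin_0 => xd.
  have : / 2 <= cos x by rewrite (_ : / 2 = cos (PI / 3));
    [apply: cos_decr_1; lra|rewrite cos_PI3; lra].
  nra.
have sdN : / sin d <= 2 * sqrt N.
  have -> : 2 * sqrt N = / (d / 2) by rewrite /d; field; lra.
  by apply: Rinv_le_contravar; lra.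
rewrite -(RInt_Chasles (g N) 0 d) //.
apply: Rle_trans (Rabs_triang _ _) _.
have B1 : Rabs (RInt (g N) 0 d) <= C / sqrt N.
  apply: Rle_trans (_ : (d - 0) * C <= _); last by right; rewrite /d; field; lra.
  apply: abs_RInt_le_const => //; first lra.
  move=> t _; rewrite Rabs_mult -(Rmult_1_r C).
  apply: Rmult_le_compat; try exact: Rabs_pos; first by case: (HC t).
  by have := hper_bound (N * cos t) => H; apply/Rabs_le_between; lra.
(* The centred [hper (N * cos t)] is the derivative of [hint (N * cos t)] divided by [- N * sin t].
   Hence [N * g N] is the derivative of the boundary term [G] plus the remainder [r]. *)
pose G t := - (qker j t * hint (N * cos t) / sin t).
pose r t := (dqker j t / sin t - qker j t * cos t / sin t ^ 2) * hint (N * cos t).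
have s0 t : d <= t <= PI / 2 -> 0 < sin t by move=> H; apply: sin_gt_0; lra.
have dG t : d <= t <= PI / 2 -> is_derive G t (N * g N t - r t).
  move=> /s0 st; rewrite /G.
  have D1 := is_derive_qker j t.
  have D2 : is_derive (fun t => hint (N * cos t)) t
      (- (N * sin t) * (hper (N * cos t) - 1 / 12)).
    apply: (is_derive_comp hint (fun t => N * cos t)); first exact: is_derive_hint.
    by auto_derive => //; ring.
  auto_derive.
    split; first by exists (dqker j t).
    split; last by split; lra.
    by exists (hper (N * cos t) - 1 / 12); apply: is_derive_hint.
  rewrite (is_derive_unique (fun x => qker j x) _ _ D1).
  rewrite (is_derive_unique (fun x => hint x) _ _ (is_derive_hint (N * cos t))).
  by rewrite /g /r; field; lra.
have cr t : d <= t <= PI / 2 -> continuous r t.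
  move=> /s0 st; apply: (continuous_mult (fun t => _ - _)); last first.
    apply: (continuous_comp (fun t => N * cos t)).
      by apply: continuous_ex_derive; auto_derive.
    apply: continuous_ex_derive.
    by exists (hper (N * cos t) - 1 / 12); apply: is_derive_hint.
  apply: (continuous_minus (fun t => dqker j t / sin t)).
    apply: (continuous_mult (dqker j)); first exact: continuous_dqker.
    by apply: continuous_ex_derive; auto_derive; lra.
  apply: (continuous_ext (fun t => qker j t * (cos t / sin t ^ 2))).
    by move=> x; rewrite /Rdiv Rmult_assoc.
  apply: (continuous_mult (qker j)); first exact: continuous_qker.
  by apply: continuous_ex_derive; auto_derive; nra.
have IG : is_RInt (fun t => N * g N t - r t) d (PI / 2) (G (PI / 2) - G d).
  apply: (is_RInt_derive G); rewrite Rmin_left ?Rmax_right; try lra; first exact: dG.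
  move=> t Ht; apply: (continuous_minus (fun t => N * g N t)); last exact: cr.
  by apply: (continuous_mult (fun=> N)); [apply: continuous_const|apply: cg].
have exr : ex_RInt r d (PI / 2).
  by apply: ex_RInt_continuous => t; rewrite Rmin_left ?Rmax_right; try lra; apply: cr.
have Ig : N * RInt (g N) d (PI / 2) = G (PI / 2) - G d + RInt r d (PI / 2).
  have I1 := is_RInt_scal _ _ _ N _ (RInt_correct _ _ _ (exg N d (PI / 2))).
  have I2 := is_RInt_plus _ _ _ _ _ _ IG (RInt_correct _ _ _ exr).
  have := is_RInt_unique _ _ _ _ I1; rewrite /scal /= /mult /= => <-.
  apply: is_RInt_unique; apply: is_RInt_ext I2 => t _.
  by rewrite /plus /=; eqR; ring.
have cN t : d <= t <= PI / 2 -> Rabs (hint (N * cos t)) <= 1.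
  by move=> H; apply: hint_bound; apply: Rmult_le_pos; [lra|apply: cos_ge_0; lra].
have BG t : d <= t <= PI / 2 -> Rabs (G t) <= C / sin t.
  move=> Ht; have st := s0 t Ht; rewrite Rabs_Ropp /Rdiv Rabs_mult Rabs_inv.
  rewrite (Rabs_right (sin t)); last lra.
  apply: Rmult_le_compat_r; first by left; apply: Rinv_0_lt_compat.
  rewrite Rabs_mult -(Rmult_1_r C).
  by apply: Rmult_le_compat; try exact: Rabs_pos; [case: (HC t)|apply: cN].
(* Because [1 <= / sin t], both parts of [r] are at most [C / sin t ^ 2], which integrates to a
   cotangent. *)
have Br : Rabs (RInt r d (PI / 2)) <= 2 * C / sin d.
  have Ic : is_RInt (fun t => 2 * C * / sin t ^ 2) d (PI / 2) (2 * C * (cos d / sin d)).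
    have -> : 2 * C * (cos d / sin d) =
       2 * C * (- (cos (PI / 2) / sin (PI / 2))) - 2 * C * (- (cos d / sin d)).
      by rewrite cos_PI2 sin_PI2; field; have := s0 d; lra.
    apply: (is_RInt_derive (fun t => 2 * C * (- (cos t / sin t))));
      rewrite Rmin_left ?Rmax_right; try lra; move=> t Ht; have st := s0 t Ht.
      by apply: is_derive_scal; apply: is_derive_cot; lra.
    by apply: continuous_ex_derive; auto_derive; nra.
  apply: Rle_trans (_ : 2 * C * (cos d / sin d) <= _); last first.
    rewrite /Rdiv Rmult_assoc; have i0 : 0 < / sin d by apply: Rinv_0_lt_compat; apply: s0; lra.
    rewrite [X in _ <= X]Rmult_assoc; apply: Rmult_le_compat_l; first lra.
    by apply: Rmult_le_compat_l; [lra|have [_] := COS_bound d; nra].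
  apply: (norm_RInt_le r (fun t => 2 * C * / sin t ^ 2) d (PI / 2)); first lra.
  - move=> t Ht; have st := s0 t Ht; rewrite /norm /= /abs /= /r Rabs_mult.
    have i1 : 1 <= / sin t.
      by rewrite -Rinv_1; apply: Rinv_le_contravar; [|case: (SIN_bound t)].
    have -> : / (sin t * (sin t * 1)) = / sin t * / sin t by field; lra.
    have -> : dqker j t / sin t - qker j t * cos t / (sin t * (sin t * 1)) =
       dqker j t * / sin t - qker j t * cos t * (/ sin t * / sin t) by field; lra.
    set i := / sin t in i1 *; have := cN t Ht.
    have [Hq Hd] := HC t; move: Hq Hd.
    have [c1 c2] := COS_bound t.
    set A := dqker j t; set B := qker j t => Hq Hd Hh.
    have -> : 2 * C * (i * i) = (2 * C * (i * i)) * 1 by ring.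
    apply: Rmult_le_compat => //; try exact: Rabs_pos.
    have Bc : Rabs (B * cos t) <= C.
      rewrite Rabs_mult -(Rmult_1_r C); apply: Rmult_le_compat; try exact: Rabs_pos => //.
        by [].
      exact/Rabs_le_between.
    apply: Rle_trans (Rabs_triang _ _) _; rewrite Rabs_Ropp !Rabs_mult.
    rewrite Rabs_mult in Bc; rewrite (Rabs_right i); last lra.
    have : i <= i * i by nra.
    have := Rabs_pos A; nra.
  - exact: RInt_correct.
  - exact: Ic.
have Bd : Rabs (G (PI / 2)) <= C by have := BG (PI / 2); rewrite sin_PI2; lra.
have {}BG : Rabs (G d) <= C / sin d by apply: BG; lra.
have B2 : Rabs (N * RInt (g N) d (PI / 2)) <= 7 * C * sqrt N.
  rewrite Ig; apply: Rle_trans (Rabs_triang _ _) _.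
  have := Rabs_triang (G (PI / 2)) (- G d); rewrite Rabs_Ropp.
  have H1 : C / sin d <= C * (2 * sqrt N) by apply: Rmult_le_compat_l; lra.
  have H2 : 2 * C / sin d <= 2 * C * (2 * sqrt N) by apply: Rmult_le_compat_l; lra.
  have H3 : C <= C * sqrt N by nra.
  rewrite /Rminus; lra.
rewrite Rabs_mult Rabs_right in B2; last lra.
have : Rabs (RInt (g N) d (PI / 2)) <= 7 * C / sqrt N.
  apply: (Rmult_le_reg_l N); first lra.
  apply: Rle_trans B2 _; right; rewrite -{2}sNN; field; lra.
have -> : 9 * C / sqrt N = C / sqrt N + 7 * C / sqrt N + C / sqrt N by field; lra.
have : 0 < C / sqrt N by apply: Rdiv_lt_0_compat.
lra.
Qed.

(** * Logarithmic growth of [sum_d kappa (Z / d) / d] *)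

Lemma is_derive_continuity_pt (f : R -> R) (x l : R) :
  is_derive f x l -> continuity_pt f x.
Proof.
by move=> D; apply/continuity_pt_filterlim; apply: (continuous_ex_derive f); exists l.
Qed.

Lemma INR_gt0 (n : nat) : (0 < n)%N -> 0 < INR n.
Proof. by move=> n0; apply: lt_0_INR; lia. Qed.

Lemma INR_ge1 (n : nat) : (0 < n)%N -> 1 <= INR n.
Proof. by move=> n0; apply: (le_INR 1); lia. Qed.

Lemma is_lim_seq_inv_INR (M : R) : is_lim_seq (fun n => M / INR n) 0.
Proof.
have L : is_lim_seq (fun n => / INR n) 0.
  by apply: (is_lim_seq_inv _ p_infty) => //; apply: is_lim_seq_INR.
by have := is_lim_seq_scal_l _ M _ L; rewrite /= Rmult_0_r.
Qed.

Lemma telescoping_dist (u : nat -> R) (M : R) (m : nat) :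
  (forall n, (m <= n)%N -> Rabs (u n.+1 - u n) <= M * (/ INR n - / INR n.+1)) ->
  forall n, (m <= n)%N -> Rabs (u n - u m) <= M * (/ INR m - / INR n).
Proof.
move=> H n /subnK <-; elim: (n - m)%N => [|i IH].
  by rewrite add0n !Rminus_diag Rabs_R0; lra.
rewrite addSn; have := H (i + m)%N (leq_addl _ _).
move: IH; set a := u _; set b := u m; set c := u _ => IH H1.
have := Rabs_triang (c - a) (a - b).
by rewrite (_ : c - a + (a - b) = c - b); lra.
Qed.

(** The majorant telescopes, giving the limit and an explicit rate together. Sums over [d], products
    over primes and sums over rough numbers all converge by this criterion. *)
Lemma telescoping_cv (u : nat -> R) (M : R) :
  (forall n, (0 < n)%N -> Rabs (u n.+1 - u n) <= M * (/ INR n - / INR n.+1)) ->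
  exists l : R, is_lim_seq u l /\ forall n, (0 < n)%N -> Rabs (l - u n) <= M / INR n.
Proof.
move=> H.
have M0 : 0 <= M.
  have := H 1%N isT; rewrite /= => H1; have := Rabs_pos (u 2%N - u 1%N); lra.
have dist n m : (0 < n)%N -> (n <= m)%N -> Rabs (u m - u n) <= M / INR n.
  move=> n0 nm.
  have := telescoping_dist u M n _ m nm.
  have : 0 < / INR m by apply: Rinv_0_lt_compat; apply: INR_gt0; lia.
  have Hn := INR_gt0 n n0.
  move=> im H1; apply: Rle_trans (H1 _) _; last by rewrite /Rdiv; nra.
  by move=> i ni; apply: H; lia.
have [l Hl] : ex_finite_lim_seq u.
  apply/ex_lim_seq_cauchy_corr => eps.
  have e2 : 0 < eps / 2 by have := cond_pos eps; lra.
  have := is_lim_seq_inv_INR M => /is_lim_seq_spec /(_ (mkposreal _ e2)) [N HN].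
  exists N.+1; move=> n m nN mN.
  have near i : (N.+1 <= i)%coq_nat -> Rabs (u i - u N.+1) < eps / 2.
    move=> iN; apply: Rle_lt_trans (dist N.+1 i _ _) _; try lia.
    have := HN N.+1 ltac:(lia); rewrite Rminus_0_r Rabs_right //.
    by apply: Rle_ge; apply: Rdiv_le_0_compat => //; apply: INR_gt0.
  have := near n nN; have := near m mN.
  have := Rabs_triang (u n - u N.+1) (- (u m - u N.+1)); rewrite Rabs_Ropp.
  by rewrite (_ : _ + - _ = u n - u m); lra.
exists l; split=> // n n0.
have L : is_lim_seq (fun m => Rabs (u m - u n)) (Rabs (l - u n)).
  apply: (is_lim_seq_abs _ (Finite (l - u n))).
  by apply: is_lim_seq_minus'; last exact: is_lim_seq_const.
apply: (is_lim_seq_le_loc _ _ _ _ _ L (is_lim_seq_const _)).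
by exists n => m nm; apply: dist => //; lia.
Qed.

Definition divsum (kap : R -> R) (Z : R) (D : nat) : R :=
  \big[Rplus/0]_(1 <= d < D.+1) (kap (Z / INR d) / INR d).

Lemma divsumS (kap : R -> R) (Z : R) (D : nat) :
  divsum kap Z D.+1 = divsum kap Z D + kap (Z / INR D.+1) / INR D.+1.
Proof. by rewrite /divsum big_nat_recr. Qed.

Definition divlim (kap : R -> R) (Z : R) : R := real (Lim_seq (divsum kap Z)).

Lemma inv_diff (n : nat) : (0 < n)%N ->
  / INR n - / INR n.+1 = / (INR n * INR n.+1).
Proof. by move=> /INR_gt0 n0; rewrite S_INR; field; lra. Qed.

Lemma linear_of_lipschitz (kap : R -> R) (C : R) :
  (forall a b, Rabs (kap a - kap b) <= C * Rabs (a - b)) -> kap 0 = 0 ->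
  forall v, 0 <= v -> Rabs (kap v) <= C * v.
Proof.
move=> lip k0 v v0; have := lip v 0.
by rewrite k0 !Rminus_0_r (Rabs_right v); lra.
Qed.

(** The Lipschitz bound and [kap 0 = 0] make the [d]-th term at most [C * Z / d^2]. The first term
    and the tail each contribute [C * Z] to the bound. *)
Lemma divlim_cv (kap : R -> R) (C Z : R) :
  (forall a b, Rabs (kap a - kap b) <= C * Rabs (a - b)) -> kap 0 = 0 ->
  0 < C -> 0 < Z ->
  is_lim_seq (divsum kap Z) (divlim kap Z) /\ Rabs (divlim kap Z) <= 2 * C * Z.
Proof.
move=> lip k0 C0 Z0.
have lin := linear_of_lipschitz kap C lip k0.
have [|l [Hl Hd]] := telescoping_cv (divsum kap Z) (C * Z).
  move=> n n0; rewrite divsumS inv_diff // Rplus_comm /Rminus Rplus_assoc Rplus_opp_r Rplus_0_r.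
  have Hn := INR_gt0 n n0; have Hn1 : INR n.+1 = INR n + 1 by rewrite S_INR.
  rewrite /Rdiv Rabs_mult (Rabs_right (/ INR n.+1)); last first.
    by apply: Rle_ge; left; apply: Rinv_0_lt_compat; lra.
  apply: Rle_trans (_ : C * (Z / INR n.+1) * / INR n.+1 <= _).
    apply: Rmult_le_compat_r; first by left; apply: Rinv_0_lt_compat; lra.
    by apply: lin; apply: Rdiv_le_0_compat; lra.
  have -> : C * (Z / INR n.+1) * / INR n.+1 = C * Z * / (INR n.+1 * INR n.+1) by field; lra.
  apply: Rmult_le_compat_l; first nra.
  by apply: Rinv_le_contravar; nra.
have -> : divlim kap Z = l by rewrite /divlim (is_lim_seq_unique _ _ Hl).
split=> //.
have := Hd 1%N isT; rewrite divsumS /divsum big_geq //= Rplus_0_l !Rdiv_1_r => H1.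
have := lin Z (Rlt_le _ _ Z0).
have := Rabs_triang (l - kap Z) (kap Z).
by rewrite (_ : l - kap Z + kap Z = l); lra.
Qed.

(** By the substitution [w = Z / t], the integral of [kap (Z / t) / t] over [[a, b]] is
    [logint kap (Z / a) - logint kap (Z / b)]. *)
Definition logint (kap : R -> R) (v : R) : R := RInt (fun w => kap w / w) 1 v.

Lemma is_derive_logint (kap : R -> R) (v : R) :
  (forall x, continuous kap x) -> 0 < v -> is_derive (logint kap) v (kap v / v).
Proof.
move=> ck v0.
have c w : 0 < w -> continuous (fun w => kap w / w) w.
  move=> w0; apply: (continuous_mult kap) => //.
  by apply: continuous_ex_derive; auto_derive; lra.
apply: (is_derive_RInt (fun w => kap w / w) _ 1); last exact: c.
apply: (locally_interval _ v 0 p_infty) => // b b0 _.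
apply: RInt_correct; apply: ex_RInt_continuous => w [w0 _]; apply: c.
by apply: Rlt_le_trans w0; apply: Rmin_pos; [lra|exact: b0].
Qed.

Lemma lipschitz_continuous (kap : R -> R) (C : R) : 0 < C ->
  (forall a b, Rabs (kap a - kap b) <= C * Rabs (a - b)) ->
  forall x, continuous kap x.
Proof.
move=> C0 lip x; apply/continuity_pt_filterlim => eps eps0.
exists (eps / C); split; first exact: Rdiv_lt_0_compat.
move=> y [_] /=; rewrite /R_dist => H.
apply: Rle_lt_trans (lip y x) _.
by rewrite Rmult_comm; apply/Rlt_div_r.
Qed.

(** The mean value theorem for [logint kap - l * ln]. It serves with [l = 0] at small arguments, and
    with [l] the limit of [kap] at large ones. *)
Lemma logint_MVT (kap : R -> R) (l v w : R) : (forall x, continuous kap x) ->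
  0 < v -> v <= w ->
  exists x, v <= x <= w /\
    logint kap w - logint kap v - l * (ln w - ln v) = (kap x - l) / x * (w - v).
Proof.
move=> ck v0 vw.
have D x : 0 < x -> is_derive (fun x => logint kap x - l * ln x) x ((kap x - l) / x).
  move=> x0.
  have -> : (kap x - l) / x = kap x / x - l * / x by field; lra.
  apply: is_derive_minus; first exact: is_derive_logint.
  by auto_derive => //; field; lra.
have [x Hx|x Hx|x []] :=
  MVT_gen (fun x => logint kap x - l * ln x) v w (fun x => (kap x - l) / x).
- by apply: D; move: Hx; rewrite Rmin_left //; lra.
- apply: is_derive_continuity_pt; apply: D.
  by move: Hx; rewrite Rmin_left //; lra.
rewrite Rmin_left // Rmax_right // => xb E; exists x; split=> //.
by rewrite -E; ring.
Qed.

(* [kap (Z / d) / d] is compared with the integral of [kap (Z / t) / t] over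
   [[d - 1, d]]; this is accurate only when [d] is large compared with [sqrt Z]. *)
Lemma divsum_step (kap : R -> R) (C M Z : R) (d : nat) : 0 < C ->
  (forall a b, Rabs (kap a - kap b) <= C * Rabs (a - b)) ->
  (forall v, 0 <= v -> Rabs (kap v) <= M) -> 0 < Z -> (0 < d)%N ->
  Rabs (kap (Z / INR d.+1) / INR d.+1
    - (logint kap (Z / INR d) - logint kap (Z / INR d.+1)))
  <= (C * Z / INR d + M) * (/ INR d - / INR d.+1).
Proof.
move=> C0 lip bnd Z0 /[dup] d0 /INR_gt0 Hd; rewrite S_INR.
have ck := lipschitz_continuous kap C C0 lip.
set n := INR d in Hd *.
have D t : 0 < t -> is_derive (fun t => logint kap (Z / t)) t (- (kap (Z / t) / t)).
  move=> t0; have Zt : 0 < Z / t by apply: Rdiv_lt_0_compat.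
  have -> : - (kap (Z / t) / t) = (- Z / t ^ 2) * (kap (Z / t) / (Z / t)).
    by field; lra.
  apply: (is_derive_comp (logint kap) (fun t => Z / t)); first exact: is_derive_logint.
  by auto_derive; [lra|field; lra].
have [x Hx|x Hx|t []] :=
  MVT_gen (fun t => logint kap (Z / t)) n (n + 1) (fun t => - (kap (Z / t) / t)).
- by apply: D; move: Hx; rewrite Rmin_left; lra.
- apply: is_derive_continuity_pt; apply: D.
  by move: Hx; rewrite Rmin_left; lra.
rewrite Rmin_left ?Rmax_right; try lra; move=> tb E.
have -> : logint kap (Z / n) - logint kap (Z / (n + 1)) = kap (Z / t) / t by lra.
have M0 : 0 <= M by have := bnd 0 (Rle_refl 0); have := Rabs_pos (kap 0); lra.
have it : / t <= / n by apply: Rinv_le_contravar; lra.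
have it' : / (n + 1) <= / t by apply: Rinv_le_contravar; lra.
have i1 : / (n + 1) <= / n by lra.
have i0 : 0 < / (n + 1) by apply: Rinv_0_lt_compat; lra.
have -> : kap (Z / (n + 1)) / (n + 1) - kap (Z / t) / t =
   (kap (Z / (n + 1)) - kap (Z / t)) * / (n + 1) + kap (Z / t) * (/ (n + 1) - / t).
  by field; lra.
apply: Rle_trans (Rabs_triang _ _) _; rewrite !Rabs_mult (Rabs_right (/ (n + 1))); last lra.
rewrite (Rabs_left1 (/ (n + 1) - / t)); last lra.
have H1 := bnd (Z / t) ltac:(apply: Rdiv_le_0_compat; lra).
have H2 := lip (Z / (n + 1)) (Z / t).
have H3 : Rabs (Z / (n + 1) - Z / t) <= Z * (/ n - / (n + 1)).
  by rewrite /Rdiv; rewrite Rabs_left1; nra.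
have H4 : Rabs (kap (Z / (n + 1)) - kap (Z / t)) * / (n + 1) <=
    C * Z / n * (/ n - / (n + 1)).
  apply: Rle_trans (_ : C * (Z * (/ n - / (n + 1))) * / n <= _); last by right; field; lra.
  apply: Rmult_le_compat; try lra; first exact: Rabs_pos.
  by apply: Rle_trans H2 _; apply: Rmult_le_compat_l; lra.
have H5 : Rabs (kap (Z / t)) * - (/ (n + 1) - / t) <= M * (/ n - / (n + 1)).
  by apply: Rmult_le_compat; try lra; exact: Rabs_pos.
lra.
Qed.

Lemma divsum_tail (kap : R -> R) (C M Z : R) (D E : nat) : 0 < C ->
  (forall a b, Rabs (kap a - kap b) <= C * Rabs (a - b)) ->
  (forall v, 0 <= v -> Rabs (kap v) <= M) -> 0 < Z -> (0 < D <= E)%N ->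
  Rabs (divsum kap Z E - divsum kap Z D
    - (logint kap (Z / INR D) - logint kap (Z / INR E)))
  <= (C * Z / INR D + M) / INR D.
Proof.
move=> C0 lip bnd Z0 /andP [D0 DE].
have HD := INR_gt0 D D0.
have M0 : 0 <= M by have := bnd 0 (Rle_refl 0); have := Rabs_pos (kap 0); lra.
pose u n := divsum kap Z n + logint kap (Z / INR n).
have CZ : 0 <= C * Z / INR D by apply: Rdiv_le_0_compat => //; nra.
have := telescoping_dist u (C * Z / INR D + M) D _ E DE.
rewrite (_ : u E - u D = divsum kap Z E - divsum kap Z D
    - (logint kap (Z / INR D) - logint kap (Z / INR E))); last by rewrite /u; ring.
move=> H; apply: Rle_trans (H _) _; last first.
  have : 0 < / INR E by apply: Rinv_0_lt_compat; apply: INR_gt0; lia.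
  by move=> HE; apply: Rmult_le_compat_l; lra.
move=> n Dn; rewrite /u divsumS.
have n0 : (0 < n)%N by lia.
have := divsum_step kap C M Z n C0 lip bnd Z0 n0.
set a := kap _ / _; set b := logint _ _; set c := logint _ _ => H1.
rewrite (_ : _ - _ = a - (b - c)); last by ring.
apply: Rle_trans H1 _; apply: Rmult_le_compat_r.
  rewrite inv_diff //; left; apply: Rinv_0_lt_compat.
  by apply: Rmult_lt_0_compat; apply: INR_gt0.
apply: Rplus_le_compat_r; apply: Rmult_le_compat_l; first nra.
by apply: Rinv_le_contravar => //; apply: le_INR; lia.
Qed.

(** For [d <= Z] both values of [kap] lie within [C * sqrt (d / Z)] of [l], which cancels. The
    resulting sum of [d^(-1/2)] is controlled by [1 / sqrt d <= 2 (sqrt d - sqrt (d - 1))]. *)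
Lemma divsum_head (kap : R -> R) (C l Z lam : R) (D : nat) : 0 < C ->
  (forall N, 1 <= N -> Rabs (kap N - l) <= C / sqrt N) ->
  0 < Z -> 1 <= lam -> INR D <= Z ->
  Rabs (divsum kap (lam * Z) D - divsum kap Z D) <= 4 * C * (sqrt (INR D) / sqrt Z).
Proof.
move=> C0 dec Z0 lam1 DZ.
have sZ : 0 < sqrt Z by apply: sqrt_lt_R0.
elim: D DZ => [|D IH] DZ.
  rewrite /divsum !big_geq // Rminus_diag Rabs_R0 /= sqrt_0 /Rdiv; lra.
have {}IH := IH ltac:(rewrite S_INR in DZ; lra).
rewrite !divsumS.
have n0 : 0 < INR D.+1 by apply: INR_gt0.
have Dn : INR D.+1 = INR D + 1 by rewrite S_INR.
have D0 := pos_INR D.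
move: IH; set A := divsum _ _ _; set B := divsum _ _ _.
set n := INR D.+1 in DZ n0 Dn *; move=> IH.
pose a := sqrt n; pose b := sqrt (INR D).
have a0 : 0 < a by apply: sqrt_lt_R0.
have b0 : 0 <= b by apply: sqrt_pos.
have aa : a * a = n by apply: sqrt_sqrt; lra.
have bb : b * b = INR D by apply: sqrt_sqrt; lra.
have ba : b <= a by apply: sqrt_le_1_alt; lra.
have d1 N : Z <= N -> Rabs (kap (N / n) - l) <= C * (a / sqrt Z).
  move=> ZN; have N1 : 1 <= N / n by apply/Rle_div_r; lra.
  apply: Rle_trans (dec _ N1) _; apply: Rmult_le_compat_l; first lra.
  rewrite (_ : a / sqrt Z = / sqrt (Z / n)).
    apply: Rinv_le_contravar; first by apply: sqrt_lt_R0; apply: Rdiv_lt_0_compat.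
    apply: sqrt_le_1_alt; apply: Rmult_le_compat_r => //.
    by left; apply: Rinv_0_lt_compat.
  by rewrite sqrt_div_alt // -/a; field; lra.
have H1 := d1 (lam * Z) ltac:(nra); have H2 := d1 Z (Rle_refl Z).
set X := kap _ in H1 *; set Y := kap _ in H2 *.
rewrite (_ : A + X / n - _ = (A - B) + ((X - l) - (Y - l)) * / n); last by field; lra.
apply: Rle_trans (Rabs_triang _ _) _.
rewrite Rabs_mult (Rabs_right (/ n)); last first.
  by apply: Rle_ge; left; apply: Rinv_0_lt_compat.
have H3 : Rabs (X - l - (Y - l)) <= 2 * (C * (a / sqrt Z)).
  by have := Rabs_triang (X - l) (- (Y - l)); rewrite Rabs_Ropp -/(X - l - (Y - l)); lra.
have H4 : Rabs (X - l - (Y - l)) * / n <= 4 * C * ((a - b) / sqrt Z).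
  apply: Rle_trans (Rmult_le_compat_r _ _ _ _ H3) _.
    by left; apply: Rinv_0_lt_compat.
  rewrite -aa (_ : 2 * _ * _ = 2 * C * / sqrt Z * / a); last by field; lra.
  rewrite (_ : 4 * C * _ = 2 * C * / sqrt Z * (2 * (a - b))); last by field; lra.
  apply: Rmult_le_compat_l.
    apply: Rmult_le_pos; first lra; left; exact: Rinv_0_lt_compat.
  apply: (Rmult_le_reg_l a) => //; rewrite Rinv_r; last lra.
  nra.
rewrite -/a (_ : 4 * C * (a / sqrt Z) = 4 * C * (b / sqrt Z) + 4 * C * ((a - b) / sqrt Z));
  last by field; lra.
by rewrite -/b in IH; lra.
Qed.

(* For [d <= eta^2 Z] the values at [Z] and [lam Z] are both close to [l]; for larger
   [d] the sum is replaced by an integral, whose dilation by [lam] is explicit. *)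
Lemma divlim_slope (kap : R -> R) (C l Lam eps : R) : 0 < C ->
  (forall a b, Rabs (kap a - kap b) <= C * Rabs (a - b)) -> kap 0 = 0 ->
  (forall N, 1 <= N -> Rabs (kap N - l) <= C / sqrt N) ->
  1 <= Lam -> 0 < eps ->
  exists Z0, 0 < Z0 /\ forall Z lam, Z0 <= Z -> 1 <= lam <= Lam ->
    Rabs (divlim kap (lam * Z) - divlim kap Z - l * ln lam) <= eps.
Proof.
move=> C0 lip k0 dec L1 eps0.
have lin := linear_of_lipschitz kap C lip k0.
have ck := lipschitz_continuous kap C C0 lip.
pose M := C + Rabs l.
have bnd v : 0 <= v -> Rabs (kap v) <= M.
  rewrite /M => v0; have Hl := Rabs_pos l; have [v1|v1] := Rle_lt_dec v 1.
    by have := lin v v0; nra.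
  have := dec v (Rlt_le _ _ v1).
  have s1 : 1 <= sqrt v by rewrite -sqrt_1; apply: sqrt_le_1_alt; lra.
  have : C / sqrt v <= C by apply/Rle_div_l; nra.
  have := Rabs_triang (kap v - l) l.
  by rewrite (_ : kap v - l + l = kap v); lra.
have M0 : 0 < M by rewrite /M; have := Rabs_pos l; lra.
(* The head contributes [4 * C * eta] and the dilation of the integral [C * Lam * eta]; together
   they are at most [eps / 2]. *)
pose eta := Rmin 1 (eps / (2 * (5 * C * Lam))).
have eta0 : 0 < eta.
  apply: Rmin_pos; first lra; apply: Rdiv_lt_0_compat => //.
  by apply: Rmult_lt_0_compat; first lra; nra.
have eta1 : eta <= 1 by apply: Rmin_l.
have etae : 5 * C * Lam * eta <= eps / 2.
  have CL : 0 < 5 * C * Lam by nra.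
  apply: Rle_trans (Rmult_le_compat_l _ _ _ (Rlt_le _ _ CL) (Rmin_r _ _)) _.
  by right; field; lra.
(* Each of the errors of [divsum_tail], at [Z] and at [lam * Z], will be at most [Q / 2 / Z]. *)
pose Q := 4 * (2 * C * Lam / eta ^ 2 + M) / eta ^ 2.
have e20 : 0 < eta ^ 2 by nra.
have Q0 : 0 < Q.
  apply: Rdiv_lt_0_compat => //.
  have : 0 < 2 * C * Lam / eta ^ 2 by apply: Rdiv_lt_0_compat => //; nra.
  lra.
(* The first bound keeps the cutoff [D] positive and at least [eta ^ 2 * Z / 2]; the second makes
   the two tails at most [eps / 2]. *)
exists (Rmax (2 / eta ^ 2) (2 * Q / eps)); split.
  by apply: Rlt_le_trans (Rmax_l _ _); apply: Rdiv_lt_0_compat; lra.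
move=> Z lam HZ lam1.
have HZ1 : 2 / eta ^ 2 <= Z by apply: Rle_trans HZ; apply: Rmax_l.
have HZ2 : 2 * Q / eps <= Z by apply: Rle_trans HZ; apply: Rmax_r.
have Z0 : 0 < Z by apply: Rlt_le_trans HZ1; apply: Rdiv_lt_0_compat; lra.
have {}HZ1 : 2 <= eta ^ 2 * Z by rewrite Rmult_comm; apply/Rle_div_l.
have {}HZ2 : Q / Z <= eps / 2.
  apply/Rle_div_l => //; move/Rle_div_l: HZ2 => /(_ eps0); lra.
have lZ0 : 0 < lam * Z by nra.
have [D HD] : exists D, eta ^ 2 * Z - 1 < INR D <= eta ^ 2 * Z.
  have [i Hi] := floor_ex (eta ^ 2 * Z); exists (Z.to_nat i).
  rewrite INR_IZR_INZ Z2Nat.id; first lra.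
  have : (-1 < i)%Z by apply: lt_IZR; lra.
  lia.
have D0 : (0 < D)%N.
  by rewrite lt0n; apply/eqP => E; move: HD; rewrite E /=; lra.
have HD0 := INR_gt0 D D0; set n := INR D in HD HD0.
have e21 : eta ^ 2 <= 1 by nra.
have nZ : n <= Z by nra.
have nZ2 : eta ^ 2 * Z <= 2 * n by lra.
have sq : sqrt n / sqrt Z <= eta.
  rewrite -sqrt_div_alt // -(sqrt_pow2 eta); last lra.
  by apply: sqrt_le_1_alt; apply/Rle_div_l => //; lra.
have head := divsum_head kap C l Z lam D C0 dec Z0 (proj1 lam1) nZ.
(* Used at the far end [v = Z / INR E], whose contribution tends to [0] with [E]. *)
have dil v : 0 < v -> Rabs (logint kap (lam * v) - logint kap v) <= C * Lam * v.
  move=> v0; have [|x [xb]] := logint_MVT kap 0 v (lam * v) ck v0; first nra.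
  rewrite Rmult_0_l !Rminus_0_r => ->; rewrite Rabs_mult Rabs_mult Rabs_inv.
  rewrite (Rabs_right x); last lra; rewrite (Rabs_right (_ - _)); last nra.
  apply: Rle_trans (_ : C * (Lam * v) <= _); last lra.
  apply: Rmult_le_compat; try nra.
    by apply: Rmult_le_pos; [exact: Rabs_pos|left; apply: Rinv_0_lt_compat; lra].
  by apply/Rle_div_l; [lra|apply: lin; lra].
(* At the near end [kap] is already close to [l], and the dilation produces the main term
   [l * ln lam]. *)
have mid : Rabs (logint kap (lam * (Z / n)) - logint kap (Z / n) - l * ln lam)
    <= C * Lam * eta.
  have V1 : 1 <= Z / n by apply/Rle_div_r; lra.
  set v := Z / n in V1 *.
  have [||x [xb E]] := logint_MVT kap l v (lam * v) ck; try nra.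
  rewrite ln_mult in E; try lra.
  rewrite (_ : l * ln lam = l * (ln lam + ln v - ln v)) ?E; last by ring.
  rewrite Rabs_mult Rabs_mult Rabs_inv.
  rewrite (Rabs_right x); last lra; rewrite (Rabs_right (lam * v - v)); last nra.
  have x1 : 1 <= x by lra.
  have H := dec x x1.
  have sx : / sqrt x <= eta.
    apply: Rle_trans sq; rewrite -sqrt_div_alt // -sqrt_inv.
    apply: sqrt_le_1_alt; rewrite (_ : n / Z = / v); last by rewrite /v; field; lra.
    by apply: Rinv_le_contravar; lra.
  have s1 : 0 < / sqrt x by apply: Rinv_0_lt_compat; apply: sqrt_lt_R0; lra.
  have ix : / x * (lam * v - v) <= Lam.
    rewrite Rmult_comm; apply/Rle_div_l; first lra.
    by apply: Rle_trans (_ : Lam * v <= _); nra.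
  rewrite Rmult_assoc.
  apply: Rle_trans (_ : C * eta * Lam <= _); last lra.
  apply: Rmult_le_compat => //; first exact: Rabs_pos.
    by apply: Rmult_le_pos; [left; apply: Rinv_0_lt_compat; lra|nra].
  by apply: Rle_trans H _; apply: Rmult_le_compat_l; lra.
have tailb N : 0 < N -> N <= Lam * Z -> (C * N / n + M) / n <= Q / 2 / Z.
  move=> N0 NL.
  have i1 : / n <= 2 / (eta ^ 2 * Z).
    apply: (Rmult_le_reg_l (n * (eta ^ 2 * Z))); first nra.
    by rewrite (_ : _ * / n = eta ^ 2 * Z); [rewrite (_ : _ * (2 / _) = 2 * n) //; field|field]; lra.
  have i2 : C * N / n <= 2 * C * Lam / eta ^ 2.
    apply: Rle_trans (_ : C * (Lam * Z) * (2 / (eta ^ 2 * Z)) <= _); last by right; field; lra.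
    apply: Rmult_le_compat => //; try nra; left; exact: Rinv_0_lt_compat.
  apply: Rle_trans (_ : (2 * C * Lam / eta ^ 2 + M) * (2 / (eta ^ 2 * Z)) <= _); last first.
    by right; rewrite /Q; field; lra.
  apply: Rmult_le_compat => //; try lra.
    have : 0 <= C * N / n by apply: Rdiv_le_0_compat => //; nra.
    lra.
  by left; apply: Rinv_0_lt_compat.
have main E : (D <= E)%N ->
  Rabs (divsum kap (lam * Z) E - divsum kap Z E - l * ln lam) <=
    eps + C * Lam * Z / INR E.
  move=> DE; have HE : 0 < INR E by apply: INR_gt0; lia.
  have DE' : (0 < D <= E)%N by rewrite D0.
  have t1 := divsum_tail kap C M (lam * Z) D E C0 lip bnd lZ0 DE'.
  have t2 := divsum_tail kap C M Z D E C0 lip bnd Z0 DE'.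
  have b1 := tailb (lam * Z) lZ0 ltac:(nra).
  have b2 := tailb Z Z0 ltac:(nra).
  have b3 : Q / 2 / Z + Q / 2 / Z <= eps / 2.
    by apply: Rle_trans HZ2; right; field; lra.
  have dE := dil (Z / INR E) ltac:(exact: Rdiv_lt_0_compat).
  have b4 : 4 * C * (sqrt n / sqrt Z) <= 4 * C * eta by apply: Rmult_le_compat_l; lra.
  have b5 : 4 * C * eta <= 4 * C * Lam * eta.
    by apply: Rmult_le_compat_r; [lra|nra].
  rewrite -/n in t1 t2 head.
  have sc x : lam * Z / x = lam * (Z / x) by rewrite /Rdiv Rmult_assoc.
  rewrite !sc in t1.
  rewrite (_ : C * Lam * Z / INR E = C * Lam * (Z / INR E)); last by rewrite /Rdiv Rmult_assoc.
  move: t1 t2 b1 b2 dE head mid => /Rabs_le_between ? /Rabs_le_between ? ? ?.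
  move=> /Rabs_le_between ? /Rabs_le_between ? /Rabs_le_between ?.
  by apply/Rabs_le_between; lra.
have [c1 _] := divlim_cv kap C (lam * Z) lip k0 C0 lZ0.
have [c2 _] := divlim_cv kap C Z lip k0 C0 Z0.
have L1' : is_lim_seq
  (fun E => Rabs (divsum kap (lam * Z) E - divsum kap Z E - l * ln lam))
  (Rabs (divlim kap (lam * Z) - divlim kap Z - l * ln lam)).
  apply: (is_lim_seq_abs _ (Finite _)).
  apply: is_lim_seq_minus'; last exact: is_lim_seq_const.
  exact: is_lim_seq_minus'.
have L2' : is_lim_seq (fun E => eps + C * Lam * Z / INR E) (eps + 0).
  by apply: is_lim_seq_plus'; [exact: is_lim_seq_const|exact: is_lim_seq_inv_INR].
rewrite -(Rplus_0_r eps).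
apply: (is_lim_seq_le_loc _ _ _ _ _ L1' L2').
by exists D => E DE; apply: main; lia.
Qed.

(** * Correcting one prime at a time *)

Lemma big_multiples (F : nat -> R) (p M : nat) : (0 < p)%N ->
  (forall r, (M < r)%N -> F r = 0) ->
  \big[Rplus/0]_(1 <= r < M.+1 | (p %| r)%N) F r =
  \big[Rplus/0]_(1 <= m < M.+1) F (p * m)%N.
Proof.
move=> p0 F0.
have H n : \big[Rplus/0]_(1 <= r < (p * n).+1 | (p %| r)%N) F r =
  \big[Rplus/0]_(1 <= m < n.+1) F (p * m)%N.
  elim: n => [|n IH]; first by rewrite muln0 !big_geq.
  rewrite big_nat_recr //= -IH.
  rewrite (big_cat_nat (n := (p * n).+1)) /=; try by rewrite ?ltnS ?leq_mul2l ?leqnSn ?orbT.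
  congr Rplus; case: p p0 {IH} => // p _.
  have Em : (p.+1 * n.+1 = (p.+1 * n + p).+1)%N by lia.
  rewrite big_mkcond Em big_nat_recr /=; last by lia.
  rewrite -Em dvdn_mulr // big_nat big1 ?Rplus_0_l //.
  move=> i Hi; case: ifP => // /dvdnP [q Eq].
  have : (n < q)%N by rewrite -(ltn_pmul2l (m := p.+1)) //; lia.
  have : (q < n.+1)%N by rewrite -(ltn_pmul2l (m := p.+1)) //; lia.
  lia.
rewrite -H (big_cat_nat (n := M.+1) (p := (p * M).+1)) //=; last first.
  by rewrite ltnS leq_pmull.
rewrite [X in _ + X]big_nat_cond [X in _ + X]big1 ?Rplus_0_r //.
by move=> i /andP [/andP [Mi _] _]; apply: F0.
Qed.

Definition gloc (n : nat) : R :=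
  let p := INR n in p ^ 2 / (p ^ 4 - 2 * p ^ 2 - p + 1).

Definition rough (N d : nat) : bool :=
  all (fun p => prime p ==> ~~ (p %| d)%N) (seq.iota 0 N).

Definition pifac (N r : nat) : R :=
  \big[Rmult/1]_(0 <= p < N | prime p && (p %| r)%N) (1 + gloc p).

Definition srough (N r : nat) : R :=
  \big[Rplus/0]_(1 <= d < r.+1 | (d %| r)%N && rough N d) (/ INR d ^ 2).

(* [Vfun N] interpolates between [sum_(d | r) d^-2] at [N = 0] and [nu r] at [N > r]. *)
Definition Vfun (N r : nat) : R := pifac N r * srough N r.

Lemma roughS (N d : nat) : rough N.+1 d = rough N d && (prime N ==> ~~ (N %| d)%N).
Proof. by rewrite /rough -addn1 iotaD all_cat /= add0n andbT. Qed.

Lemma roughP (N d : nat) :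
  reflect (forall p, (p < N)%N -> prime p -> ~~ (p %| d)%N) (rough N d).
Proof.
apply: (iffP allP) => H p.
  by move=> pN pp; have := H p; rewrite mem_iota add0n pN pp; apply.
by rewrite mem_iota add0n => /andP [_ pN]; apply/implyP; apply: H.
Qed.

Lemma sroughE (N r M : nat) : (0 < r <= M)%N ->
  srough N r = \big[Rplus/0]_(1 <= d < M.+1 | (d %| r)%N && rough N d) (/ INR d ^ 2).
Proof.
move=> /andP [r0 rM].
rewrite [RHS](big_cat_nat (n := r.+1)) //= [X in _ + X]big_nat_cond.
rewrite [X in _ + X]big_pred0 ?Rplus_0_r // => d.
apply/negP => /andP [/andP [rd _]] /andP [/dvdn_leq dr _].
by have := dr r0; lia.
Qed.

Lemma rough_mul (p m : nat) : prime p -> rough p (p * m) = rough p m.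
Proof.
move=> pp; apply/roughP/roughP => H q qp qq; have := H q qp qq; apply: contra.
  by move=> qm; apply: dvdn_mull.
rewrite Euclid_dvdM // => /orP [|//]; rewrite dvdn_prime2 // => /eqP E.
by rewrite E ltnn in qp.
Qed.

Lemma pifac_mul (p m : nat) : prime p -> pifac p (p * m) = pifac p m.
Proof.
move=> pp; rewrite /pifac big_nat_cond [RHS]big_nat_cond; apply: eq_bigl => q.
case qp: (0 <= q < p)%N => //=; case qq: (prime q) => //=.
rewrite Euclid_dvdM // dvdn_prime2 //; case: eqP => // E.
by move: qp; rewrite E ltnn ?andbF.
Qed.

Lemma srough_mul (p m : nat) : prime p -> (0 < m)%N ->
  srough p.+1 (p * m) = srough p.+1 m.
Proof.
move=> pp m0; have p0 := prime_gt0 pp.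
rewrite [RHS](sroughE _ _ (p * m)); last by rewrite m0 leq_pmull.
apply: eq_bigl => d; case R: (rough p.+1 d); rewrite ?andbF //.
move: R; rewrite roughS pp /= => /andP [_ npd]; congr andb.
by rewrite Gauss_dvdr // coprime_sym prime_coprime.
Qed.

Lemma sroughS_not_prime (N r : nat) : ~~ prime N -> srough N.+1 r = srough N r.
Proof.
by move=> np; apply: eq_bigl => d; rewrite roughS (negbTE np) andbT.
Qed.

(** The divisors that are lost are [p * e] with [e] dividing [r / p]. Here [e] may again be
    divisible by [p], so that [srough p], not [srough p.+1], appears on the right. *)
Lemma sroughS_prime (p r : nat) : prime p -> (0 < r)%N ->
  srough p.+1 r = srough p r - / INR p ^ 2 *
    (if (p %| r)%N then srough p (r %/ p) else 0).
Proof.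
move=> pp r0; have p0 := prime_gt0 pp; have Hp := INR_gt0 p p0.
pose F d := if (d %| r)%N && rough p d then / INR d ^ 2 else 0.
have F0 d : (r < d)%N -> F d = 0.
  rewrite /F; case: ifP => // /andP [/dvdn_leq dr _] rd.
  by have := dr r0; lia.
have E : \big[Rplus/0]_(1 <= d < r.+1 | (p %| d)%N) F d =
    / INR p ^ 2 * (if (p %| r)%N then srough p (r %/ p) else 0).
  rewrite big_multiples // /F; case: ifP => pr.
    have rp : (0 < r %/ p)%N by rewrite divn_gt0 // dvdn_leq.
    rewrite (sroughE p (r %/ p) r) ?rp ?leq_div // [in RHS]big_mkcond big_distrr /=.
    rewrite big_nat [RHS]big_nat; apply: eq_bigr => d /andP [d0 _].
    rewrite rough_mul // dvdn_divRL // (mulnC d).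
    case: ifP => _; last by rewrite Rmult_0_r.
    rewrite -multE mult_INR; have := INR_gt0 d d0 => Hd; field; lra.
  rewrite big1 ?Rmult_0_r // => d _; case: ifP => // /andP [/(dvdn_trans _) pd _].
  by rewrite pd ?dvdn_mulr in pr.
rewrite -E /srough [X in _ = X - _](bigID (fun d => p %| d)%N) /=.
rewrite (_ : \big[Rplus/0]_(1 <= d < r.+1 | (p %| d)%N) F d =
  \big[Rplus/0]_(1 <= d < r.+1 | (d %| r)%N && rough p d && (p %| d)%N) / INR d ^ 2).
  rewrite (eq_bigl (fun d => (d %| r)%N && rough p d && ~~ (p %| d)%N)) => [|d].
    by set a := bigop.body _ _ _; set b := bigop.body _ _ _; ring.
  by rewrite roughS pp andbA.
rewrite /F big_mkcond [RHS]big_mkcond; apply: eq_bigr => d _.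
by case: (p %| d)%N; rewrite ?andbF ?andbT.
Qed.

(** The half-way stage at a prime [p]: its multiples are sieved out of the divisor sum, but its
    local factor is not yet inserted. The two half-steps become [1 - S_p / p] and [1 + p g p S_p] on
    [Sfun], the extra factor [p] coming from [Sfun_shift]. *)
Definition Wfun (N r : nat) : R := pifac N r * srough N.+1 r.

Lemma WfunE (p r : nat) : prime p -> (0 < r)%N ->
  Wfun p r = Vfun p r - / INR p ^ 2 * (if (p %| r)%N then Vfun p (r %/ p) else 0).
Proof.
move=> pp r0; rewrite /Wfun /Vfun sroughS_prime //.
case: ifP => pr; last by ring.
have {1}-> : pifac p r = pifac p (r %/ p).
  by rewrite -[in LHS](divnK pr) mulnC pifac_mul.
rewrite {1}(_ : pifac p r = pifac p (r %/ p)); first by ring.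
by rewrite -[in LHS](divnK pr) mulnC pifac_mul.
Qed.

(** [Wfun p] takes the same value at [r] and [r / p], so multiplication by the local factor when [p]
    divides [r] can be written as a shift. *)
Lemma VfunS_prime (p r : nat) : prime p -> (0 < r)%N ->
  Vfun p.+1 r = Wfun p r + gloc p * (if (p %| r)%N then Wfun p (r %/ p) else 0).
Proof.
move=> pp r0; rewrite /Vfun /Wfun {1}/pifac big_mkcond big_nat_recr //= -big_mkcond.
rewrite -/(pifac p r) pp /=; case: ifP => pr; last by ring.
have rp : (0 < r %/ p)%N by rewrite divn_gt0 ?prime_gt0 // dvdn_leq.
have E1 : pifac p r = pifac p (r %/ p).
  by rewrite -[in LHS](divnK pr) mulnC pifac_mul.
have E2 : srough p.+1 r = srough p.+1 (r %/ p).
  by rewrite -[in LHS](divnK pr) mulnC srough_mul.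
by rewrite E1 E2; ring.
Qed.

Lemma VfunS_not_prime (N r : nat) : ~~ prime N -> Vfun N.+1 r = Vfun N r.
Proof.
move=> np; rewrite /Vfun sroughS_not_prime // {1}/pifac big_mkcond big_nat_recr //=.
by rewrite -big_mkcond (negbTE np) Rmult_1_r.
Qed.

Lemma rough_small (N d : nat) : (0 < d < N)%N -> rough N d -> d = 1%N.
Proof.
move=> /andP [d0 dN] /roughP H; apply/eqP; rewrite eqn_leq d0 andbT leqNgt.
apply/negP => d1; have := H (pdiv d); rewrite pdiv_prime // pdiv_dvd => /(_ _ isT).
by move=> H'; have := H' (leq_ltn_trans (pdiv_leq d0) dN).
Qed.

Lemma Vfun_nu (N r : nat) : (0 < r < N)%N -> Vfun N r = nu r.
Proof.
move=> /andP [r0 rN].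
have -> : Vfun N r = pifac N r.
  rewrite /Vfun -[RHS]Rmult_1_r; congr Rmult.
  rewrite /srough big_mkcond big_nat_recl //= dvd1n.
  have -> : rough N 1.
    by apply/roughP => p _ pp; rewrite dvdn1; case: p pp => [|[|]].
  rewrite big_nat big1 => [|d /andP [d0 dr]]; first by rewrite /=; field.
  case: ifP => // /andP [_ H]; exfalso.
  by have := rough_small N d.+1 _ H; lia.
rewrite /nu /pifac -big_filter; apply: perm_big.
apply: uniq_perm; [exact/filter_uniq/iota_uniq|exact: primes_uniq|move=> p].
rewrite mem_filter mem_index_iota mem_primes r0 /=.
case pp: (prime p) => //=; case pr: (p %| r)%N => //=.
by apply: leq_ltn_trans rN; apply: dvdn_leq.
Qed.

Definition Sfun (j : nat) (V : nat -> R) (M : nat) (Z : R) : R :=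
  \big[Rplus/0]_(1 <= r < M.+1) (V r * (INR r * kker j (Z / INR r))).

Lemma kker_big_index (j r : nat) (Z : R) : 0 < Z <= INR r -> kker j (Z / INR r) = 0.
Proof.
move=> H; apply: kker_le1; split; first by apply: Rdiv_le_0_compat; lra.
by apply/Rle_div_l; lra.
Qed.

(** Terms with [r >= Z] vanish with [kker] on [[0, 1]], so every cutoff from [Z] on is
    equivalent. *)
Lemma Sfun_bound (j : nat) (V : nat -> R) (M1 M2 : nat) (Z : R) :
  0 < Z <= INR M1 -> 0 < Z <= INR M2 -> Sfun j V M1 Z = Sfun j V M2 Z.
Proof.
wlog M12 : M1 M2 / (M1 <= M2)%N => [H H1 H2|H1 H2].
  by have [/H|/ltnW/H] := leqP M1 M2; [apply|move=> ->].
rewrite /Sfun [RHS](big_cat_nat (n := M1.+1)) //= [X in _ + X]big_nat.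
rewrite [X in _ + X]big1 ?Rplus_0_r // => r Hr.
rewrite kker_big_index ?Rmult_0_r //; split; first lra.
by apply: Rle_trans (proj2 H1) _; apply: le_INR; lia.
Qed.

Lemma Sfun_shift (j p M : nat) (V : nat -> R) (Z : R) : (0 < p)%N -> 0 < Z <= INR M ->
  Sfun j (fun r => if (p %| r)%N then V (r %/ p) else 0) M Z =
  INR p * Sfun j V M (Z / INR p).
Proof.
move=> p0 ZM; have Hp := INR_gt0 p p0.
pose F r := V (r %/ p)%N * (INR r * kker j (Z / INR r)).
rewrite /Sfun (eq_bigr (fun r => if (p %| r)%N then F r else 0)); last first.
  by move=> r _; case: ifP => // _; rewrite Rmult_0_l.
rewrite -big_mkcond big_multiples //.
  rewrite big_distrr /= big_nat [RHS]big_nat; apply: eq_bigr => m /andP [m0 _].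
  have Hm := INR_gt0 m m0.
  rewrite /F mulKn // -multE mult_INR.
  rewrite (_ : Z / (INR p * INR m) = Z / INR p / INR m); first by ring.
  by field; lra.
move=> r Mr; rewrite /F kker_big_index ?Rmult_0_r //; split; first lra.
by apply: Rle_trans (proj2 ZM) _; apply: le_INR; lia.
Qed.

Lemma Sfun_comb (j M : nat) (V1 V2 V : nat -> R) (a Z : R) :
  (forall r, (0 < r)%N -> V r = V1 r + a * V2 r) ->
  Sfun j V M Z = Sfun j V1 M Z + a * Sfun j V2 M Z.
Proof.
move=> H; rewrite /Sfun big_distrr -big_split /= big_nat [RHS]big_nat.
by apply: eq_bigr => r /andP [r0 _]; rewrite H //; ring.
Qed.

Lemma Sfun_step (j p M : nat) (Z : R) : prime p -> 0 < Z <= INR M ->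
  Sfun j (Vfun p.+1) M Z = Sfun j (Vfun p) M Z
    + (gloc p * INR p - / INR p) * Sfun j (Vfun p) M (Z / INR p)
    - gloc p * Sfun j (Vfun p) M (Z / INR p / INR p).
Proof.
move=> pp ZM; have p0 := prime_gt0 pp; have Hp := INR_gt0 p p0; have p1 := INR_ge1 p p0.
have ZpM : 0 < Z / INR p <= INR M.
  split; first by apply: Rdiv_lt_0_compat; lra.
  by apply/Rle_div_l => //; nra.
rewrite (Sfun_comb _ _ _ _ _ _ _ (fun r r0 => VfunS_prime p r pp r0)) Sfun_shift //.
have HW r : (0 < r)%N -> Wfun p r = Vfun p r + (- / INR p ^ 2) *
    (if (p %| r)%N then Vfun p (r %/ p) else 0).
  by move=> r0; rewrite WfunE //; ring.
rewrite !(Sfun_comb _ _ _ _ _ _ _ HW) !Sfun_shift //.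
by field; lra.
Qed.

(** Exchange the sums over [r] and [d]: the multiples of [d] reproduce, with weight [d^-2 * d], the
    unweighted sum at [Z / d], which [kappa_sum] evaluates. *)
Lemma Sfun_Vfun0 (j M : nat) (Z : R) : (0 < j)%N -> 0 < Z <= INR M ->
  divsum (kappa j) Z M = Sfun j (Vfun 0) M Z +
    (- 1) ^ j / (2 * INR j + 1) * Z / 2 * \big[Rplus/0]_(1 <= d < M.+1) (/ INR d ^ 2).
Proof.
move=> j0 ZM.
have -> : Sfun j (Vfun 0) M Z =
    \big[Rplus/0]_(1 <= d < M.+1) (/ INR d * Sfun j (fun=> 1) M (Z / INR d)).
  rewrite /Sfun big_nat (eq_bigr (fun r => \big[Rplus/0]_(1 <= d < M.+1)
     (/ INR d ^ 2 * ((if (d %| r)%N then 1 else 0) * (INR r * kker j (Z / INR r)))))).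
    rewrite -big_nat exchange_big /= big_nat [RHS]big_nat.
    apply: eq_bigr => d /andP [d0 _]; have Hd := INR_gt0 d d0.
    rewrite -big_distrr /=; have := Sfun_shift j d M (fun=> 1) Z d0 ZM.
    by rewrite /Sfun => ->; set a := bigop.body _ _ _; field; lra.
  move=> r /andP [r0 rM].
  have -> : Vfun 0 r = srough 0 r by rewrite /Vfun /pifac big_geq // Rmult_1_l.
  rewrite (sroughE 0 r M); last by rewrite r0.
  rewrite big_mkcond big_distrl /=; apply: eq_bigr => d _; rewrite andbT.
  by case: ifP => _; ring.
rewrite /divsum big_distrr -big_split /= big_nat [RHS]big_nat.
apply: eq_bigr => d /andP [d0 _]; have Hd := INR_gt0 d d0; have Hd1 := INR_ge1 d d0.
rewrite (kappa_sum j M) //; last first.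
  split; first by apply: Rdiv_lt_0_compat; lra.
  by apply/Rle_div_l => //; nra.
have -> : Sfun j (fun=> 1) M (Z / INR d) =
    \big[Rplus/0]_(1 <= m < M.+1) (INR m * kker j (Z / INR d / INR m)).
  by apply: eq_bigr => m _; rewrite Rmult_1_l.
by set a := bigop.body _ _ _; have ? := pos_INR j; field; lra.
Qed.

Lemma zeta2_cv : exists z : R,
  is_lim_seq (fun M => \big[Rplus/0]_(1 <= d < M.+1) (/ INR d ^ 2)) z.
Proof.
pose u M := \big[Rplus/0]_(1 <= d < M.+1) (/ INR d ^ 2).
have uS M : u M.+1 = u M + / INR M.+1 ^ 2 by rewrite /u big_nat_recr.
have [|l [Hl _]] := telescoping_cv u 1; last by exists l.
move=> n n0; rewrite uS inv_diff //.
have Hn := INR_gt0 n n0.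
rewrite (_ : u n + _ - u n = / INR n.+1 ^ 2); last by ring.
rewrite Rmult_1_l S_INR Rabs_right.
  by apply: Rinv_le_contravar; nra.
by apply: Rle_ge; left; apply: Rinv_0_lt_compat; nra.
Qed.

Definition zeta2 : R :=
  real (Lim_seq (fun M => \big[Rplus/0]_(1 <= d < M.+1) (/ INR d ^ 2))).

Lemma is_lim_zeta2 :
  is_lim_seq (fun M => \big[Rplus/0]_(1 <= d < M.+1) (/ INR d ^ 2)) zeta2.
Proof. by have [z Hz] := zeta2_cv; rewrite /zeta2 (is_lim_seq_unique _ _ Hz). Qed.

(** If [Vfun N r] is written as the sum of [h d] over [d | r], this is the sum of all [h d], the
    constant that governs the linear term in [Z]. *)
Definition cfac (N : nat) : R :=
  zeta2 * \big[Rmult/1]_(0 <= p < N | prime p) ((1 + gloc p) * (1 - / INR p ^ 2)).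

(** * The functions [K] with finitely many primes corrected *)

Definition ceil_nat (Z : R) : nat := (Z.to_nat (Int_part Z)).+1.

Lemma ceil_natP (Z : R) : 0 < Z -> 0 < Z <= INR (ceil_nat Z).
Proof.
move=> Z0; split=> //; rewrite /ceil_nat S_INR INR_IZR_INZ; have := base_Int_part Z.
rewrite Z2Nat.id; first lra.
have [_ H] := base_Int_part Z.
have : (-1 < Int_part Z)%Z by apply: lt_IZR; lra. 
lia.
Qed.

Definition Kgen (j : nat) (V : nat -> R) (c Z : R) : R :=
  Sfun j V (ceil_nat Z) Z + c * (- 1) ^ j / (2 * INR j + 1) * Z / 2.

Definition Kfun (j N : nat) : R -> R := Kgen j (Vfun N) (cfac N).

Lemma KgenE (j M : nat) (V : nat -> R) (c Z : R) : 0 < Z <= INR M ->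
  Kgen j V c Z = Sfun j V M Z + c * (- 1) ^ j / (2 * INR j + 1) * Z / 2.
Proof.
by move=> ZM; rewrite /Kgen (Sfun_bound _ _ _ M) //; apply: ceil_natP; lra.
Qed.

(** Once [M >= Z], increasing [M] in [Sfun_Vfun0] changes only the partial sum of [zeta2]. *)
Lemma Kfun0 (j : nat) (Z : R) : (0 < j)%N -> 0 < Z -> Kfun j 0 Z = divlim (kappa j) Z.
Proof.
move=> j0 Z0; have [N1 ZN1] := ceil_natP Z Z0; have Hj := pos_INR j.
set s := (- 1) ^ j / (2 * INR j + 1) * Z / 2.
suff H : is_lim_seq (divsum (kappa j) Z) (Kfun j 0 Z).
  by rewrite /divlim (is_lim_seq_unique _ _ H).
apply: (is_lim_seq_ext_loc (fun M => Sfun j (Vfun 0) (ceil_nat Z) Z +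
    s * \big[Rplus/0]_(1 <= d < M.+1) (/ INR d ^ 2))).
  exists (ceil_nat Z) => M HM; have ZM : 0 < Z <= INR M.
    by split=> //; apply: Rle_trans ZN1 _; apply: le_INR.
  by rewrite Sfun_Vfun0 // (Sfun_bound _ _ (ceil_nat Z) M).
have -> : Kfun j 0 Z = Sfun j (Vfun 0) (ceil_nat Z) Z + s * zeta2.
  rewrite /Kfun /Kgen /cfac big_geq // /s; field; lra.
apply: is_lim_seq_plus'; first exact: is_lim_seq_const.
exact: (is_lim_seq_scal_l _ s (Finite zeta2) is_lim_zeta2).
Qed.

Lemma Kfun_step (j p : nat) (Z : R) : prime p -> 0 < Z ->
  Kfun j p.+1 Z = Kfun j p Z
    + (gloc p * INR p - / INR p) * Kfun j p (Z / INR p)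
    + (- gloc p) * Kfun j p (Z / INR p ^ 2).
Proof.
move=> pp Z0; have p0 := prime_gt0 pp; have Hp := INR_gt0 p p0; have p1 := INR_ge1 p p0.
have Hj := pos_INR j.
have ZM := ceil_natP Z Z0; set M := ceil_nat Z in ZM.
have i1 : / INR p <= 1 by rewrite -Rinv_1; apply: Rinv_le_contravar; lra.
have i0 : 0 < / INR p by apply: Rinv_0_lt_compat.
have -> : Z / INR p ^ 2 = Z / INR p / INR p by field; lra.
have ZpM : 0 < Z / INR p <= INR M by rewrite /Rdiv; split; nra.
have ZppM : 0 < Z / INR p / INR p <= INR M.
  by move: ZpM; rewrite /Rdiv => ZpM; split; nra.
rewrite /Kfun !(KgenE j M) // Sfun_step //.
rewrite /cfac [in X in _ + X = _]big_mkcond big_nat_recr //= -big_mkcond pp.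
set a := bigop.body _ _ _; field; lra.
Qed.

Lemma KfunS_not_prime (j N : nat) (Z : R) : ~~ prime N -> Kfun j N.+1 Z = Kfun j N Z.
Proof.
move=> np; rewrite /Kfun /Kgen; congr Rplus.
  by apply: eq_bigr => r _; rewrite VfunS_not_prime.
rewrite /cfac [in LHS]big_mkcond big_nat_recr //= -big_mkcond (negbTE np).
by rewrite Rmult_1_r.
Qed.

(** * Size of the local factors and convergence of products over primes *)

Lemma gloc_den_gt0 (p : R) : 2 <= p -> p ^ 4 * (7 / 16) <= p ^ 4 - 2 * p ^ 2 - p + 1.
Proof.
move=> p2.
(* The constant [7 / 16] gives equality at [p = 2]. *)
have : 0 <= (p - 2) * p by nra.
have : 0 <= (p - 2) * (p * p * p) by nra.
have : 0 <= (p - 2) * (p * p) by nra.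
nra.
Qed.

(** [gloc p] agrees with [p^-2] to leading order, so [p g p - 1 / p] is [(2 p^2 + p - 1) / (p D)],
    of order [p^-3], with [D] the denominator of [gloc]. The factor [10] is generous; the right side
    is in the form that telescopes. *)
Lemma gloc_coef_bound (n : nat) : (2 <= n)%N ->
  0 <= gloc n /\ Rabs (gloc n * INR n - / INR n) + Rabs (- gloc n)
   <= 10 * (/ INR n - / INR n.+1).
Proof.
move=> n2; have p2 : 2 <= INR n by apply: (le_INR 2); lia.
rewrite inv_diff; last lia.
rewrite S_INR /gloc; set p := INR n in p2 *.
have den := gloc_den_gt0 p p2; set D := _ + 1 in den *.
have p0 : 0 < p by lra.
have p4 : 0 < p ^ 4 by apply: pow_lt.
have D0 : 0 < D by lra.
have iD : 0 < / D by apply: Rinv_0_lt_compat.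
split; first by apply: Rmult_le_pos; [nra|lra].
have E1 : p ^ 2 / D * p - / p = (2 * p ^ 2 + p - 1) / (p * D).
  have -> : 2 * p ^ 2 + p - 1 = p ^ 4 - D by rewrite /D; ring.
  by field; lra.
have E2 : - (p ^ 2 / D) = - (p ^ 3 / (p * D)) by field; lra.
have ipD : 0 < / (p * D) by apply: Rinv_0_lt_compat; nra.
rewrite E1 E2 Rabs_Ropp (Rabs_right (_ / _)); last first.
  by apply: Rle_ge; apply: Rmult_le_pos; nra.
rewrite (Rabs_right (p ^ 3 / _)); last first.
  by apply: Rle_ge; apply: Rmult_le_pos; [left; apply: pow_lt|lra].
rewrite -Rdiv_plus_distr.
apply: (Rmult_le_reg_r (p * D)); first nra.
rewrite (_ : _ / (p * D) * (p * D) = 2 * p ^ 2 + p - 1 + p ^ 3); last by field; lra.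
rewrite (_ : 10 * / (p * (p + 1)) * (p * D) = 10 * D / (p + 1)); last by field; lra.
apply/Rle_div_r; first lra.
apply: Rle_trans (_ : 10 * (p ^ 4 * (7 / 16)) <= _); last lra.
have : 0 <= (p - 2) * p by nra.
have : 0 <= (p - 2) * (p * p * p) by nra.
have : 0 <= (p - 2) * (p * p) by nra.
nra.
Qed.

Lemma inv_diff_gt0 (n : nat) : (0 < n)%N -> 0 < / INR n - / INR n.+1.
Proof.
move=> n0; rewrite inv_diff //; apply: Rinv_0_lt_compat.
by apply: Rmult_lt_0_compat; apply: INR_gt0.
Qed.

(** These exponentials dominate the partial products of [1 + 10 (1 / i - 1 / (i + 1))], so
    recursions with such factors stay below [exp 10]. *)
Lemma exp_growth_step (n : nat) : (0 < n)%N ->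
  (1 + 10 * (/ INR n - / INR n.+1)) * exp (10 * (1 - / INR n))
  <= exp (10 * (1 - / INR n.+1)).
Proof.
move=> n0.
have -> : 10 * (1 - / INR n.+1) = 10 * (/ INR n - / INR n.+1) + 10 * (1 - / INR n).
  by ring.
rewrite exp_plus; apply: Rmult_le_compat_r; first by left; apply: exp_pos.
exact: exp_ineq1_le.
Qed.

Lemma exp_growth_le (n : nat) : (0 < n)%N -> exp (10 * (1 - / INR n)) <= exp 10.
Proof.
move=> n0; have i0 : 0 < / INR n by apply: Rinv_0_lt_compat; apply: INR_gt0.
by left; apply: exp_increasing; lra.
Qed.

Lemma prime_prodS (f : nat -> R) (N : nat) :
  \big[Rmult/1]_(0 <= p < N.+1 | prime p) f p =
  \big[Rmult/1]_(0 <= p < N | prime p) f p * (if prime N then f N else 1).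
Proof. by rewrite [LHS]big_mkcond big_nat_recr //= -big_mkcond. Qed.

Lemma prime_prod_cv (e : nat -> R) :
  (forall n, prime n -> Rabs (e n) <= 10 * (/ INR n - / INR n.+1)) ->
  ex_finite_lim_seq (fun N => \big[Rmult/1]_(0 <= p < N | prime p) (1 + e p)).
Proof.
move=> He; pose x N := \big[Rmult/1]_(0 <= p < N | prime p) (1 + e p).
pose e' n := if prime n then e n else 0.
have He' n : (0 < n)%N -> Rabs (e' n) <= 10 * (/ INR n - / INR n.+1).
  rewrite /e'; case: ifP => [/He //|_ n0]; rewrite Rabs_R0.
  by have := inv_diff_gt0 n n0; lra.
have xS n : x n.+1 = x n * (1 + e' n).
  by rewrite /x prime_prodS /e'; case: ifP => _; rewrite ?Rplus_0_r.
have x1 : x 1%N = 1 by rewrite xS /x big_geq // /e' /=; ring.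
have xb n : Rabs (x n.+1) <= exp (10 * (1 - / INR n.+1)).
  elim: n => [|n IH].
    by rewrite x1 Rabs_R1 /= Rinv_1 Rminus_diag Rmult_0_r exp_0; lra.
  apply: Rle_trans (exp_growth_step n.+1 isT); rewrite xS Rabs_mult Rmult_comm.
  apply: Rmult_le_compat => //; try exact: Rabs_pos.
  apply: Rle_trans (Rabs_triang _ _) _; rewrite Rabs_R1.
  by have := He' n.+1 isT; lra.
have [|l [Hl _]] := telescoping_cv x (10 * exp 10); last by exists l.
move=> n n0; rewrite xS (_ : _ - _ = x n * e' n); last by ring.
rewrite Rabs_mult (_ : 10 * exp 10 * _ = exp 10 * (10 * (/ INR n - / INR n.+1))); last by ring.
apply: Rmult_le_compat; try exact: Rabs_pos; last exact: He'.
by case: n n0 => // n _; apply: Rle_trans (xb n) (exp_growth_le n.+1 isT).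
Qed.

Definition aop (N : nat) : R := if prime N then gloc N * INR N - / INR N else 0.
Definition bop (N : nat) : R := if prime N then - gloc N else 0.

(** The corrections with every dilation replaced by [1]; each factor is
    [(1 + p g p) (1 - 1 / p)]. *)
Definition Afac (N : nat) : R :=
  \big[Rmult/1]_(0 <= p < N | prime p) (1 + (gloc p * INR p - / INR p - gloc p)).

Lemma AfacS (N : nat) : Afac N.+1 = Afac N * (1 + aop N + bop N).
Proof.
by rewrite /Afac prime_prodS /aop /bop; case: ifP => _; congr Rmult; ring.
Qed.

Lemma Kfun_rec (j N : nat) (Z : R) : 0 < Z ->
  Kfun j N.+1 Z = Kfun j N Z + aop N * Kfun j N (Z / INR N)
    + bop N * Kfun j N (Z / INR N ^ 2).
Proof.
move=> Z0; rewrite /aop /bop; case: ifP => pp; first by rewrite Kfun_step.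
by rewrite KfunS_not_prime ?pp //; ring.
Qed.

Lemma aop_bop_bound (N : nat) : (0 < N)%N ->
  Rabs (aop N) + Rabs (bop N) <= 10 * (/ INR N - / INR N.+1).
Proof.
move=> N0; rewrite /aop /bop; case: ifP => pp.
  by have [_] := gloc_coef_bound N (prime_gt1 pp).
by rewrite Rabs_R0; have := inv_diff_gt0 N N0; lra.
Qed.

Lemma Afac_cv : ex_finite_lim_seq Afac.
Proof.
apply: prime_prod_cv => n pn; have [_] := gloc_coef_bound n (prime_gt1 pn).
apply: Rle_trans; rewrite Rabs_Ropp.
have := Rabs_triang (gloc n * INR n - / INR n) (- gloc n).
by rewrite Rabs_Ropp.
Qed.

(** * Logarithmic slopes, and bounds uniform in the number of primes *)

Definition slope (j : nat) : R := (- 1) ^ j * (PI / 2) / 12.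

Lemma kappa_constants (j : nat) : exists C, 0 < C /\
  (forall a b, Rabs (kappa j a - kappa j b) <= C * Rabs (a - b)) /\
  (forall N, 1 <= N -> Rabs (kappa j N - slope j) <= C / sqrt N).
Proof.
have [C1 [C10 H1]] := kappa_lipschitz j; have [C2 [C20 H2]] := kappa_decay j.
exists (C1 + C2); split; first lra; split=> [a b|N N1].
  by apply: Rle_trans (H1 a b) _; have := Rabs_pos (a - b); nra.
apply: Rle_trans (H2 N N1) _; apply: Rmult_le_compat_r; last lra.
by left; apply: Rinv_0_lt_compat; apply: sqrt_lt_R0; lra.
Qed.

(** A correction combines three dilates of [K], all with the same slope, so it multiplies the slope
    by [1 + aop N + bop N]. The threshold grows by [INR N ^ 2] to cover the dilate at
    [Z / INR N ^ 2], and hence depends on [N]. *)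
Lemma Kfun_slope (j N : nat) (Lam eps : R) : (0 < j)%N -> 1 <= Lam -> 0 < eps ->
  exists Z0, 0 < Z0 /\ forall Z lam, Z0 <= Z -> 1 <= lam <= Lam ->
    Rabs (Kfun j N (lam * Z) - Kfun j N Z - Afac N * slope j * ln lam) <= eps.
Proof.
move=> j0 L1; have [C [C0 [lip dec]]] := kappa_constants j.
elim: N eps => [|N IH] eps e0.
  have [Z0 [Z00 H]] := divlim_slope _ C _ Lam eps C0 lip (kappa0 j) dec L1 e0.
  exists Z0; split=> // Z lam ZZ lam1.
  by rewrite /Afac big_geq // Rmult_1_l !Kfun0 //; [apply: H|lra|nra].
case pp: (prime N); last first.
  have [Z0 [Z00 H]] := IH eps e0; exists Z0; split=> // Z lam ZZ lam1.
  rewrite !KfunS_not_prime ?pp // AfacS /aop /bop pp !Rplus_0_r Rmult_1_r.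
  exact: H.
have N1 := INR_ge1 N (prime_gt0 pp).
pose T := 1 + Rabs (aop N) + Rabs (bop N).
have Ha := Rabs_pos (aop N); have Hb := Rabs_pos (bop N).
have T0 : 0 < T by rewrite /T; lra.
have [Z0 [Z00 H]] := IH (eps / T) (Rdiv_lt_0_compat _ _ e0 T0).
have N2 : INR N <= INR N ^ 2 by nra.
exists (Z0 * INR N ^ 2); split; first nra.
move=> Z lam ZZ lam1.
have Zp : 0 < Z by nra.
have H1 := H Z lam ltac:(nra) lam1.
have H2 := H (Z / INR N) lam ltac:(apply/Rle_div_r; nra) lam1.
have H3 := H (Z / INR N ^ 2) lam ltac:(apply/Rle_div_r; nra) lam1.
rewrite !Kfun_rec; [|nra|nra].
rewrite !(_ : forall x, lam * Z / x = lam * (Z / x)); try by move=> x; rewrite /Rdiv Rmult_assoc.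
move: H1 H2 H3; set d1 := _ - _ - _; set d2 := _ - _ - _; set d3 := _ - _ - _ => H1 H2 H3.
rewrite (_ : _ - _ - _ = d1 + (aop N * d2 + bop N * d3)); last first.
  by rewrite AfacS /d1 /d2 /d3; ring.
have -> : eps = eps / T + (Rabs (aop N) * (eps / T) + Rabs (bop N) * (eps / T)).
  by rewrite {1}(_ : eps = T * (eps / T)); [rewrite /T; ring|field; lra].
apply: Rle_trans (Rabs_triang _ _) _; apply: Rplus_le_compat => //.
apply: Rle_trans (Rabs_triang _ _) _; rewrite !Rabs_mult.
by apply: Rplus_le_compat; apply: Rmult_le_compat_l.
Qed.

Lemma Kfun1 (j : nat) (Z : R) : Kfun j 1 Z = Kfun j 0 Z.
Proof. exact: KfunS_not_prime. Qed.

Lemma Kfun0_linear (j : nat) : (0 < j)%N ->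
  exists C, 0 < C /\ forall Z, 0 < Z -> Rabs (Kfun j 0 Z) <= C * Z.
Proof.
move=> j0; have [C [C0 [lip _]]] := kappa_constants j.
exists (2 * C); split; first lra; move=> Z Z0; rewrite Kfun0 //.
by have [] := divlim_cv (kappa j) C Z lip (kappa0 j) C0 Z0.
Qed.

(** For [N = 0] large [Z] is handled by the slope and small [Z] by the linear bound. Since this
    covers all [Z > 0], each correction only multiplies the bound by [1 + |aop| + |bop|]. *)
Lemma Kfun_diff_bound (j : nat) (Lam : R) : (0 < j)%N -> 1 <= Lam ->
  exists B, 0 < B /\ forall N Z lam, (0 < N)%N -> 0 < Z -> 1 <= lam <= Lam ->
    Rabs (Kfun j N (lam * Z) - Kfun j N Z) <= B.
Proof.
move=> j0 L1; have [C [C0 lin]] := Kfun0_linear j j0.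
have [Z0 [Z00 H]] := Kfun_slope j 0 Lam 1 j0 L1 Rlt_0_1.
pose B0 := 1 + Rabs (slope j) * ln Lam + C * (Lam * Z0) + C * Z0.
have lnL : 0 <= ln Lam by rewrite -ln_1; apply: ln_le; lra.
have Hs := Rabs_pos (slope j).
have B00 : 0 < B0.
  rewrite /B0; have : 0 < C * Z0 by nra.
  have : 0 < C * (Lam * Z0) by apply: Rmult_lt_0_compat => //; nra.
  nra.
have base Z lam : 0 < Z -> 1 <= lam <= Lam ->
    Rabs (Kfun j 0 (lam * Z) - Kfun j 0 Z) <= B0.
  move=> Zp lam1; have [ZZ|ZZ] := Rle_lt_dec Z0 Z.
    have := H Z lam ZZ lam1; rewrite /Afac big_geq // Rmult_1_l => H1.
    have ll : 0 <= ln lam <= ln Lam.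
      by split; [rewrite -ln_1; apply: ln_le; lra|apply: ln_le; lra].
    have := Rabs_triang (Kfun j 0 (lam * Z) - Kfun j 0 Z - slope j * ln lam)
      (slope j * ln lam).
    rewrite Rabs_mult (Rabs_right (ln lam)); last lra.
    rewrite (_ : _ - _ + _ = Kfun j 0 (lam * Z) - Kfun j 0 Z); last by ring.
    have : Rabs (slope j) * ln lam <= Rabs (slope j) * ln Lam.
      by apply: Rmult_le_compat_l; lra.
    have : 0 < C * (Lam * Z0) by apply: Rmult_lt_0_compat => //; nra.
    have : 0 < C * Z0 by nra.
    rewrite /B0; lra.
  have := Rabs_triang (Kfun j 0 (lam * Z)) (- Kfun j 0 Z); rewrite Rabs_Ropp.
  have := lin Z Zp; have := lin (lam * Z) ltac:(nra).
  have : C * (lam * Z) <= C * (Lam * Z0).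
    by apply: Rmult_le_compat_l; [lra|nra].
  have : C * Z <= C * Z0 by nra.
  rewrite -/(Kfun j 0 (lam * Z) - Kfun j 0 Z) /B0; nra.
have gen N Z lam : 0 < Z -> 1 <= lam <= Lam ->
    Rabs (Kfun j N.+1 (lam * Z) - Kfun j N.+1 Z) <= B0 * exp (10 * (1 - / INR N.+1)).
  elim: N Z lam => [|N IH] Z lam Zp lam1.
    rewrite /= Rinv_1 Rminus_diag Rmult_0_r exp_0 Rmult_1_r !Kfun1.
    exact: base.
  have N0 : 0 < INR N.+1 by apply: INR_gt0.
  have H1 := IH Z lam Zp lam1.
  have H2 := IH (Z / INR N.+1) lam ltac:(exact: Rdiv_lt_0_compat) lam1.
  have H3 := IH (Z / INR N.+1 ^ 2) lam ltac:(apply: Rdiv_lt_0_compat => //; nra) lam1.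
  rewrite !(Kfun_rec j N.+1); [|nra|nra].
  rewrite !(_ : forall x, lam * Z / x = lam * (Z / x)); try by move=> x; rewrite /Rdiv Rmult_assoc.
  move: H1 H2 H3; set d1 := Kfun _ _ _ - Kfun _ _ _; set d2 := Kfun _ _ _ - Kfun _ _ _;
    set d3 := Kfun _ _ _ - Kfun _ _ _.
  move: (exp_growth_step N.+1 isT); set E := exp _; set E' := exp _ => EE H1 H2 H3.
  rewrite (_ : _ - _ = d1 + (aop N.+1 * d2 + bop N.+1 * d3)); last first.
    by rewrite /d1 /d2 /d3; ring.
  have Ha := Rabs_pos (aop N.+1); have Hb := Rabs_pos (bop N.+1).
  apply: Rle_trans (_ : B0 * E * (1 + (Rabs (aop N.+1) + Rabs (bop N.+1))) <= _); last first.
    have op := aop_bop_bound N.+1 isT.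
    have E0 : 0 < E by apply: exp_pos.
    rewrite Rmult_assoc; apply: Rmult_le_compat_l; first lra.
    by apply: Rle_trans EE; rewrite Rmult_comm; apply: Rmult_le_compat_r; lra.
  apply: Rle_trans (Rabs_triang _ _) _.
  have := Rabs_triang (aop N.+1 * d2) (bop N.+1 * d3); rewrite !Rabs_mult.
  have : Rabs (aop N.+1) * Rabs d2 <= Rabs (aop N.+1) * (B0 * E).
    exact: Rmult_le_compat_l.
  have : Rabs (bop N.+1) * Rabs d3 <= Rabs (bop N.+1) * (B0 * E).
    exact: Rmult_le_compat_l.
  lra.
exists (B0 * exp 10); split; first by apply: Rmult_lt_0_compat => //; apply: exp_pos.
case=> // N Z lam _ Zp lam1; apply: Rle_trans (gen N Z lam Zp lam1) _.
by apply: Rmult_le_compat_l; [lra|apply: exp_growth_le].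
Qed.

(** The rate does not depend on [Z]; this permits fixing the number of primes first and letting [Z]
    grow afterwards. *)
Lemma Kfun_diff_cauchy (j : nat) (Lam : R) : (0 < j)%N -> 1 <= Lam ->
  exists B, 0 < B /\ forall N M Z lam, (0 < N <= M)%N -> 0 < Z -> 1 <= lam <= Lam ->
    Rabs ((Kfun j M (lam * Z) - Kfun j M Z) - (Kfun j N (lam * Z) - Kfun j N Z))
      <= B / INR N.
Proof.
move=> j0 L1; have [B [B0 HB]] := Kfun_diff_bound j Lam j0 L1.
exists (10 * B); split; first lra.
move=> N M Z lam /andP [N0 NM] Zp lam1.
have HN := INR_gt0 N N0.
have HM : 0 < / INR M by apply: Rinv_0_lt_compat; apply: INR_gt0; lia.
have := telescoping_dist (fun N => Kfun j N (lam * Z) - Kfun j N Z) (10 * B) N _ M NM.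
move=> H; apply: Rle_trans (H _) _; last by rewrite /Rdiv; nra.
move=> n Nn; have n0 : (0 < n)%N by lia.
have Hn := INR_gt0 n n0.
rewrite !Kfun_rec; [|nra|nra].
rewrite !(_ : forall x, lam * Z / x = lam * (Z / x)); try by move=> x; rewrite /Rdiv Rmult_assoc.
have H2 := HB n (Z / INR n) lam n0 ltac:(exact: Rdiv_lt_0_compat) lam1.
have H3 := HB n (Z / INR n ^ 2) lam n0 ltac:(apply: Rdiv_lt_0_compat => //; nra) lam1.
move: H2 H3; set d2 := Kfun _ _ _ - Kfun _ _ _; set d3 := Kfun _ _ _ - Kfun _ _ _ => H2 H3.
rewrite (_ : _ - _ - _ = aop n * d2 + bop n * d3); last by rewrite /d2 /d3; ring.
apply: Rle_trans (Rabs_triang _ _) _; rewrite !Rabs_mult.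
have : Rabs (aop n) * Rabs d2 <= Rabs (aop n) * B.
  by apply: Rmult_le_compat_l => //; apply: Rabs_pos.
have : Rabs (bop n) * Rabs d3 <= Rabs (bop n) * B.
  by apply: Rmult_le_compat_l => //; apply: Rabs_pos.
have := aop_bop_bound n n0; nra.
Qed.

(** * The Euler product of [zeta 2] *)

Definition roughsum (N M : nat) : R :=
  \big[Rplus/0]_(1 <= d < M.+1 | rough N d) (/ INR d ^ 2).

Lemma roughsumS (N M : nat) : roughsum N M.+1 =
  roughsum N M + (if rough N M.+1 then / INR M.+1 ^ 2 else 0).
Proof. by rewrite /roughsum big_mkcond big_nat_recr // -big_mkcond. Qed.

Lemma roughsum_cv (N : nat) : exists l : R, is_lim_seq (roughsum N) l /\
  forall n, (0 < n)%N -> Rabs (l - roughsum N n) <= 1 / INR n.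
Proof.
apply: telescoping_cv => n n0; rewrite roughsumS inv_diff //.
have Hn := INR_gt0 n n0.
have Hn1 : INR n.+1 = INR n + 1 by rewrite S_INR.
have P : 0 < / INR n.+1 ^ 2 <= / (INR n * INR n.+1).
  split; first by apply: Rinv_0_lt_compat; nra.
  by apply: Rinv_le_contravar; nra.
case: ifP => _; rewrite Rmult_1_l.
  rewrite (_ : _ + _ - _ = / INR n.+1 ^ 2); last by ring.
  by rewrite Rabs_right; lra.
by rewrite Rplus_0_r Rminus_diag Rabs_R0; lra.
Qed.

Definition zeta2_inv_prod (N : nat) : R := \big[Rmult/1]_(0 <= p < N | prime p) (1 - / INR p ^ 2).

(** With the cutoff [p * M] the multiples of [p] correspond exactly to [d <= M], so the sieve
    identity has no error term. *)
Lemma roughsum_prime (p M : nat) : prime p ->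
  roughsum p.+1 (p * M) = roughsum p (p * M) - / INR p ^ 2 * roughsum p M.
Proof.
move=> pp; have p0 := prime_gt0 pp; have Hp := INR_gt0 p p0.
pose F d := if (d <= p * M)%N && rough p d then / INR d ^ 2 else 0.
have E : \big[Rplus/0]_(1 <= d < (p * M).+1 | (p %| d)%N) F d = / INR p ^ 2 * roughsum p M.
  rewrite big_multiples //; last by rewrite /F => r; rewrite ltnNge => /negbTE ->.
  rewrite (big_cat_nat (n := M.+1)) //=; last by rewrite ltnS leq_pmull.
  rewrite [X in _ + X]big_nat [X in _ + X]big1 => [|d /andP [Md _]]; last first.
    by rewrite /F leq_pmul2l // leqNgt Md.
  rewrite Rplus_0_r /roughsum [in RHS]big_mkcond big_distrr /=.
  rewrite big_nat [RHS]big_nat; apply: eq_bigr => d /andP [d0 dM].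
  rewrite /F leq_pmul2l // rough_mul // (_ : (d <= M)%N) //=.
  case: ifP => _; last by rewrite Rmult_0_r.
  by rewrite -multE mult_INR; have := INR_gt0 d d0 => Hd; field; lra.
rewrite -E /roughsum [X in _ = X - _](bigID (fun d => p %| d)%N) /=.
rewrite (_ : \big[Rplus/0]_(1 <= d < (p * M).+1 | (p %| d)%N) F d =
  \big[Rplus/0]_(1 <= d < (p * M).+1 | rough p d && (p %| d)%N) / INR d ^ 2).
  rewrite (eq_bigl (fun d => rough p d && ~~ (p %| d)%N)) => [|d].
    by set a := bigop.body _ _ _; set b := bigop.body _ _ _; ring.
  by rewrite roughS pp.
rewrite /F big_nat_cond [RHS]big_nat_cond big_mkcond [RHS]big_mkcond.
apply: eq_bigr => d _.
case Hd: (0 < d < (p * M).+1)%N => //=.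
have -> : (d <= p * M)%N by move: Hd; lia.
by case: (p %| d)%N; case: (rough p d).
Qed.

Lemma roughsum_lim (N : nat) : is_lim_seq (roughsum N) (zeta2 * zeta2_inv_prod N).
Proof.
elim: N => [|N IH].
  rewrite /zeta2_inv_prod big_geq // Rmult_1_r.
  by apply: is_lim_seq_ext is_lim_zeta2 => M; apply: eq_bigl.
rewrite /zeta2_inv_prod prime_prodS -/(zeta2_inv_prod N); case: ifP => pp; last first.
  rewrite Rmult_1_r; apply: is_lim_seq_ext IH => M; apply: eq_bigl => d.
  by rewrite roughS pp andbT.
(* The sieve identity only reaches cutoffs divisible by [N]. Since the whole sequence is known to
   converge, this subsequence identifies its limit. *)
have [l [Hl _]] := roughsum_cv N.+1.
have p0 := prime_gt0 pp.
have sub u (a : R) : is_lim_seq u a -> is_lim_seq (fun M => u (N * M)%N) a.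
  apply: is_lim_seq_subseq; apply: eventually_subseq => n.
  by rewrite mulnS; lia.
have L2 : is_lim_seq (fun M => roughsum N.+1 (N * M)%N)
    (zeta2 * zeta2_inv_prod N - / INR N ^ 2 * (zeta2 * zeta2_inv_prod N)).
  apply: (is_lim_seq_ext (fun M => roughsum N (N * M) - / INR N ^ 2 * roughsum N M)).
    by move=> M; rewrite roughsum_prime.
  apply: is_lim_seq_minus'; first exact: (sub (roughsum N)).
  exact: (is_lim_seq_scal_l _ _ (Finite _) IH).
have := is_lim_seq_unique _ _ (sub (roughsum N.+1) l Hl).
rewrite (is_lim_seq_unique _ _ L2) => -[E].
by have -> : zeta2 * (zeta2_inv_prod N * (1 - / INR N ^ 2)) = l by rewrite -E /=; ring.
Qed.

(** Every [d] with [1 < d < N] has a prime factor below [N], so the rough sum up to [N - 1] is [1],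
    and the rest is at most [1 / (N - 1)]. *)
Lemma euler_zeta2 : is_lim_seq (fun N => zeta2 * zeta2_inv_prod N) 1.
Proof.
have B N : (1 < N)%N -> Rabs (zeta2 * zeta2_inv_prod N - 1) <= 1 / INR N.-1.
  move=> N1; have [l [Hl Hd]] := roughsum_cv N.
  have := is_lim_seq_unique _ _ Hl; rewrite (is_lim_seq_unique _ _ (roughsum_lim N)) => -[->].
  have := Hd N.-1 ltac:(lia); suff -> : roughsum N N.-1 = 1 by [].
  rewrite /roughsum big_mkcond big_nat_recl /=; last by lia.
  have -> : rough N 1.
    by apply/roughP => p _ pp; rewrite dvdn1; case: p pp => [|[|]].
  rewrite big_nat big1 => [|d /andP [d0 dr]]; first by field.
  case: ifP => // H; exfalso.
  by have := rough_small N d.+1 _ H; lia.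
apply/is_lim_seq_incr_1/is_lim_seq_incr_1.
have L : is_lim_seq (fun n => 1 / INR n.+1) 0.
  exact/(is_lim_seq_incr_1 (fun n => 1 / INR n))/is_lim_seq_inv_INR.
apply: (is_lim_seq_le_le (fun n => 1 - 1 / INR n.+1) _ (fun n => 1 + 1 / INR n.+1)).
- by move=> n; have /Rabs_le_between := B n.+2 isT; rewrite [_.-1]/=; lra.
- by rewrite -[X in is_lim_seq _ (Finite X)]Rminus_0_r;
    apply: is_lim_seq_minus' => //; apply: is_lim_seq_const.
- by rewrite -[X in is_lim_seq _ (Finite X)]Rplus_0_r;
    apply: is_lim_seq_plus' => //; apply: is_lim_seq_const.
Qed.

(** * Passage to the weight [nu] *)

Definition Gfac (N : nat) : R := \big[Rmult/1]_(0 <= p < N | prime p) (1 + gloc p).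

Lemma Gfac_cv : ex_finite_lim_seq Gfac.
Proof.
apply: prime_prod_cv => n pn; have [_] := gloc_coef_bound n (prime_gt1 pn).
by rewrite Rabs_Ropp; have := Rabs_pos (gloc n * INR n - / INR n); lra.
Qed.

Lemma cfac_lim (G : R) : is_lim_seq Gfac G -> is_lim_seq cfac G.
Proof.
move=> HG; apply: (is_lim_seq_ext (fun N => zeta2 * zeta2_inv_prod N * Gfac N)) => [N|].
  by rewrite /cfac big_split /= -/(zeta2_inv_prod N) -/(Gfac N); ring.
by rewrite -(Rmult_1_l G); apply: is_lim_seq_mult' => //; apply: euler_zeta2.
Qed.

(** For fixed [Z] the sum is that of [nu] as soon as [N] exceeds the cutoff; from then on only the
    linear coefficient moves. *)
Lemma Kfun_lim (j : nat) (G Z : R) : is_lim_seq Gfac G -> 0 < Z ->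
  is_lim_seq (fun N => Kfun j N Z) (Kgen j nu G Z).
Proof.
move=> HG Z0; have Hj := pos_INR j.
set s := (- 1) ^ j / (2 * INR j + 1) * Z / 2.
have -> : Kgen j nu G Z = Sfun j nu (ceil_nat Z) Z + s * G by rewrite /Kgen /s; field; lra.
apply: (is_lim_seq_ext_loc (fun N => Sfun j nu (ceil_nat Z) Z + s * cfac N)).
  exists (ceil_nat Z).+1 => N HN; rewrite /Kfun /Kgen; congr Rplus.
    rewrite /Sfun big_nat [RHS]big_nat; apply: eq_bigr => r Hr.
    by rewrite Vfun_nu //; lia.
  by rewrite /s; field; lra.
apply: is_lim_seq_plus'; first exact: is_lim_seq_const.
exact: (is_lim_seq_scal_l _ _ (Finite _) (cfac_lim G HG)).
Qed.

Lemma Kgen_slope (j : nat) (G A Lam eps : R) : (0 < j)%N -> 1 <= Lam -> 0 < eps ->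
  is_lim_seq Gfac G -> is_lim_seq Afac A ->
  exists Z0, 0 < Z0 /\ forall Z lam, Z0 <= Z -> 1 <= lam <= Lam ->
    Rabs (Kgen j nu G (lam * Z) - Kgen j nu G Z - A * slope j * ln lam) <= eps.
Proof.
move=> j0 L1 e0 HG HA.
have [B [B0 HB]] := Kfun_diff_cauchy j Lam j0 L1.
have e3 : 0 < eps / 3 by lra.
pose T := Rabs (slope j) * ln Lam + 1.
have lnL : 0 <= ln Lam by rewrite -ln_1; apply: ln_le; lra.
have Hs := Rabs_pos (slope j).
have T0 : 0 < T by rewrite /T; nra.
have eT : 0 < eps / 3 / T by apply: Rdiv_lt_0_compat.
have lim_lt u (l : R) e : is_lim_seq u l -> 0 < e ->
    exists N, forall n, (N <= n)%N -> Rabs (u n - l) < e.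
  move=> /is_lim_seq_spec H ep; have [N HN] := H (mkposreal _ ep).
  by exists N => n Nn; apply: HN; lia.
have [N1 HN1] := lim_lt _ _ _ (is_lim_seq_inv_INR B) e3.
have [N2 HN2] := lim_lt _ _ _ HA eT.
(* [N] is fixed by [eps] and [Lam] alone, and only then is the threshold on [Z] taken from
   [Kfun_slope]. *)
pose N := (N1 + N2).+1.
have [Z0 [Z00 HZ]] := Kfun_slope j N Lam (eps / 3) j0 L1 e3.
exists Z0; split=> // Z lam ZZ lam1.
have Zp : 0 < Z by lra.
have lZp : 0 < lam * Z by nra.
have ll : 0 <= ln lam <= ln Lam.
  by split; [rewrite -ln_1; apply: ln_le; lra|apply: ln_le; lra].
have H1 : Rabs ((Kgen j nu G (lam * Z) - Kgen j nu G Z)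
    - (Kfun j N (lam * Z) - Kfun j N Z)) <= eps / 3.
  apply: Rle_trans (_ : B / INR N <= _); last first.
    have := HN1 N ltac:(rewrite /N; lia); rewrite Rminus_0_r Rabs_right; first lra.
    by apply: Rle_ge; apply: Rdiv_le_0_compat; [lra|apply: INR_gt0].
  have L : is_lim_seq (fun M => Rabs ((Kfun j M (lam * Z) - Kfun j M Z)
      - (Kfun j N (lam * Z) - Kfun j N Z)))
    (Rabs ((Kgen j nu G (lam * Z) - Kgen j nu G Z) - (Kfun j N (lam * Z) - Kfun j N Z))).
    apply: (is_lim_seq_abs _ (Finite _)); apply: is_lim_seq_minus'.
      by apply: is_lim_seq_minus'; apply: Kfun_lim.
    exact: is_lim_seq_const.
  apply: (is_lim_seq_le_loc _ _ _ _ _ L (is_lim_seq_const _)).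
  by exists N => M NM; apply: HB => //; rewrite /N in NM *; lia.
have H2 := HZ Z lam ZZ lam1.
have H3 : Rabs (Afac N * slope j * ln lam - A * slope j * ln lam) <= eps / 3.
  rewrite (_ : _ - _ = (Afac N - A) * (slope j * ln lam)); last by ring.
  rewrite Rabs_mult (Rabs_mult (slope j)) (Rabs_right (ln lam)); last lra.
  have := HN2 N ltac:(rewrite /N; lia) => H3.
  apply: Rle_trans (_ : eps / 3 / T * T <= _); last by right; field; lra.
  apply: Rmult_le_compat; try exact: Rabs_pos; try lra.
    by apply: Rmult_le_pos; [exact: Rabs_pos|lra].
  have : Rabs (slope j) * ln lam <= Rabs (slope j) * ln Lam.
    by apply: Rmult_le_compat_l; lra.
  rewrite /T; lra.
move: H1 H2 H3 => /Rabs_le_between ? /Rabs_le_between ? /Rabs_le_between ?.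
by apply/Rabs_le_between; lra.
Qed.

(** * The value of [zeta 2] *)

(* [cosB n / cosA n - cosB n.+1 / cosA n.+1 = 1 / (2 (n + 1)^2)], so that the partial
   sums of [zeta 2] telescope. *)
Definition cosA (n : nat) : R := RInt (fun x => cos x ^ (2 * n)) 0 (PI / 2).
Definition cosB (n : nat) : R := RInt (fun x => x ^ 2 * cos x ^ (2 * n)) 0 (PI / 2).

Lemma is_RInt_cosA (n : nat) : is_RInt (fun x => cos x ^ (2 * n)) 0 (PI / 2) (cosA n).
Proof.
apply: RInt_correct; apply: ex_RInt_continuous => x _.
by apply: continuous_ex_derive; auto_derive.
Qed.

Lemma is_RInt_cosB (n : nat) :
  is_RInt (fun x => x ^ 2 * cos x ^ (2 * n)) 0 (PI / 2) (cosB n).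
Proof.
apply: RInt_correct; apply: ex_RInt_continuous => x _.
by apply: continuous_ex_derive; auto_derive.
Qed.

Lemma cos_pow_PI2 (n : nat) : cos (PI / 2) ^ n.+1 = 0.
Proof. by rewrite cos_PI2 /= Rmult_0_l. Qed.

(** Wallis's recurrence, from the primitive [sin x * cos x ^ (2 n + 1)], which vanishes at both
    ends. *)
Lemma cosA_rec (n : nat) : 2 * (INR n + 1) * cosA n.+1 = (2 * INR n + 1) * cosA n.
Proof.
suff H : is_RInt (fun x => 2 * (INR n + 1) * cos x ^ (2 * n.+1)
    - (2 * INR n + 1) * cos x ^ (2 * n)) 0 (PI / 2) 0.
  have I := is_RInt_minus _ _ _ _ _ _
    (is_RInt_scal _ _ _ (2 * (INR n + 1)) _ (is_RInt_cosA n.+1))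
    (is_RInt_scal _ _ _ (2 * INR n + 1) _ (is_RInt_cosA n)).
  have := is_RInt_unique _ _ _ _ I; rewrite (is_RInt_unique _ _ _ _ H).
  rewrite /minus /plus /opp /scal /= /mult /=; lra.
have E : sin (PI / 2) * cos (PI / 2) ^ (2 * n).+1 - sin 0 * cos 0 ^ (2 * n).+1 = 0.
  by rewrite cos_pow_PI2 sin_0; ring.
rewrite -[X in is_RInt _ _ _ X]E.
apply: (is_RInt_antiderivative (fun x => sin x * cos x ^ (2 * n).+1)) => x; last first.
  by apply: continuous_ex_derive; auto_derive.
auto_derive => //.
have -> : (2 * n.+1 = (2 * n).+2)%N by lia.
have Hk : INR (2 * n).+1 = 2 * INR n + 1 by rewrite S_INR -multE mult_INR.
rewrite -/(INR (2 * n).+1) Hk.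
have := sin2_cos2 x; rewrite /Rsqr => H.
have Hs : sin x * sin x = 1 - cos x * cos x by lra.
set c := cos x ^ _.
have -> : cos x ^ (2 * n).+2 = cos x * (cos x * c) by [].
transitivity (cos x * (cos x * c) - (2 * INR n + 1) * ((sin x * sin x) * c)).
  by rewrite /c; ring.
by rewrite Hs; ring.
Qed.

(** Two integrations by parts of [cosA n.+1], raising the power of [x] from [0] to [2]; [F] collects
    both boundary terms. *)
Lemma cosB_rec (n : nat) :
  cosA n.+1 = (INR n + 1) * ((2 * INR n + 1) * cosB n - 2 * (INR n + 1) * cosB n.+1).
Proof.
suff H : is_RInt (fun x => cos x ^ (2 * n.+1) + (INR n + 1) *
    (2 * (INR n + 1) * (x ^ 2 * cos x ^ (2 * n.+1))
     - (2 * INR n + 1) * (x ^ 2 * cos x ^ (2 * n)))) 0 (PI / 2) 0.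
  have I := is_RInt_plus _ _ _ _ _ _ (is_RInt_cosA n.+1)
    (is_RInt_scal _ _ _ (INR n + 1) _ (is_RInt_minus _ _ _ _ _ _
    (is_RInt_scal _ _ _ (2 * (INR n + 1)) _ (is_RInt_cosB n.+1))
    (is_RInt_scal _ _ _ (2 * INR n + 1) _ (is_RInt_cosB n)))).
  have := is_RInt_unique _ _ _ _ I; rewrite (is_RInt_unique _ _ _ _ H).
  rewrite /minus /plus /opp /scal /= /mult /=; lra.
pose F x := x * cos x ^ (2 * n).+2 + (INR n + 1) * (x ^ 2 * (sin x * cos x ^ (2 * n).+1)).
have E : F (PI / 2) - F 0 = 0.
  by rewrite /F !cos_pow_PI2 sin_0; ring.
rewrite -[X in is_RInt _ _ _ X]E.
apply: (is_RInt_antiderivative F) => x; last first.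
  by apply: continuous_ex_derive; auto_derive.
rewrite /F; auto_derive => //.
have -> : (2 * n.+1 = (2 * n).+2)%N by lia.
have Hk : INR (2 * n).+1 = 2 * INR n + 1 by rewrite S_INR -multE mult_INR.
rewrite -/(INR (2 * n).+1) Hk.
have := sin2_cos2 x; rewrite /Rsqr => H.
have Hs : sin x * sin x = 1 - cos x * cos x by lra.
set c := cos x ^ _.
have -> : cos x ^ (2 * n).+2 = cos x * (cos x * c) by [].
transitivity (cos x * (cos x * c) + (INR n + 1) * (x * x) * (cos x * (cos x * c)
   - (2 * INR n + 1) * ((sin x * sin x) * c))).
  by rewrite /c /=; ring.
by rewrite Hs; ring.
Qed.

Lemma cosA0 : cosA 0 = PI / 2.
Proof.
apply: is_RInt_unique.
rewrite -[X in is_RInt _ _ _ X]Rminus_0_r.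
apply: (is_RInt_antiderivative id) => x; last exact: continuous_const.
exact: is_derive_id.
Qed.

Lemma cosB0 : cosB 0 = PI ^ 3 / 24.
Proof.
apply: is_RInt_unique.
have -> : PI ^ 3 / 24 = (PI / 2) ^ 3 / 3 - 0 ^ 3 / 3 by field.
apply: (is_RInt_antiderivative (fun x => x ^ 3 / 3)) => x.
  by auto_derive => //=; field.
by apply: continuous_ex_derive; auto_derive.
Qed.

Lemma cosA_gt0 (n : nat) : 0 < cosA n.
Proof.
elim: n => [|n IH]; first by rewrite cosA0; have := PI_RGT_0; lra.
have := cosA_rec n; have := pos_INR n => n0 H.
apply: (Rmult_lt_reg_l (2 * (INR n + 1))); first lra.
by rewrite H Rmult_0_r; apply: Rmult_lt_0_compat; lra.
Qed.

Lemma mul_cos_le_sin (x : R) : 0 <= x <= PI / 2 -> x * cos x <= sin x.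
Proof.
move=> xb; have pi0 := PI_RGT_0.
have D t : is_derive (fun t => sin t - t * cos t) t (t * sin t).
  by auto_derive => //; ring.
have [t _|t _|t []] := MVT_gen (fun t => sin t - t * cos t) 0 x (fun t => t * sin t).
- exact: D.
- exact: is_derive_continuity_pt (D t).
rewrite Rmin_left ?Rmax_right; try lra; rewrite sin_0 => tb E.
have st : 0 <= sin t by apply: sin_ge_0; lra.
have : 0 <= t * sin t * (x - 0).
  by apply: Rmult_le_pos; [apply: Rmult_le_pos|]; lra.
lra.
Qed.

(** From [x * cos x <= sin x], the integrand is at most [sin x ^ 2 * cos x ^ (2 n)], a difference of
    consecutive integrands of [cosA]. *)
Lemma cosB_bound (n : nat) : 0 <= cosB n.+1 <= cosA n - cosA n.+1.
Proof.
have pi0 := PI_RGT_0; split.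
  apply: (is_RInt_ge_0 _ 0 (PI / 2) _ _ (is_RInt_cosB n.+1)); first lra.
  move=> x xb; apply: Rmult_le_pos; first nra.
  by apply: pow_le; apply: cos_ge_0; lra.
have I := is_RInt_minus _ _ _ _ _ _ (is_RInt_cosA n) (is_RInt_cosA n.+1).
apply: (is_RInt_le _ _ 0 (PI / 2) _ _ _ (is_RInt_cosB n.+1) I); first lra.
move=> x xb; rewrite (_ : (2 * n.+1 = (2 * n).+2)%N); last by lia.
rewrite -[minus _ _]/(cos x ^ (2 * n) - cos x ^ (2 * n).+2).
have c0 : 0 <= cos x by apply: cos_ge_0; lra.
have H1 := mul_cos_le_sin x ltac:(lra).
have := sin2_cos2 x; rewrite /Rsqr => H.
set k := (2 * n)%N.
have -> : cos x ^ k.+2 = cos x * cos x * cos x ^ k by rewrite /=; ring.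
have : 0 <= cos x ^ k by apply: pow_le.
set c := cos x ^ k => cp.
have H2 : (x * cos x) * (x * cos x) <= sin x * sin x.
  by apply: Rmult_le_compat => //; apply: Rmult_le_pos; lra.
rewrite (_ : x ^ 2 * _ = (x * cos x) * (x * cos x) * c); last by ring.
nra.
Qed.

(** The constant [PI ^ 2 / 6] is [2 * cosB 0 / cosA 0], the starting value of the telescoping
    sum. *)
Lemma zeta2_partial (M : nat) :
  \big[Rplus/0]_(1 <= d < M.+1) (/ INR d ^ 2) = PI ^ 2 / 6 - 2 * cosB M / cosA M.
Proof.
elim: M => [|M IH].
  by rewrite big_geq // cosA0 cosB0; field; have := PI_RGT_0; lra.
have -> : \big[Rplus/0]_(1 <= d < M.+2) (/ INR d ^ 2) =
    \big[Rplus/0]_(1 <= d < M.+1) (/ INR d ^ 2) + / INR M.+1 ^ 2 by rewrite big_nat_recr.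
rewrite IH.
have A0 := cosA_gt0 M; have A1 := cosA_gt0 M.+1; have M0 := pos_INR M.
have E1 := cosA_rec M; have E2 := cosB_rec M.
have -> : cosB M.+1 = ((2 * INR M + 1) * cosB M - cosA M.+1 / (INR M + 1)) / (2 * (INR M + 1)).
  by rewrite {1}E2; field; lra.
have -> : cosA M.+1 = (2 * INR M + 1) * cosA M / (2 * (INR M + 1)).
  by rewrite -E1; field; lra.
rewrite S_INR; field; lra.
Qed.

Lemma zeta2E : zeta2 = PI ^ 2 / 6.
Proof.
suff H : is_lim_seq (fun M => \big[Rplus/0]_(1 <= d < M.+1) (/ INR d ^ 2)) (PI ^ 2 / 6).
  by rewrite /zeta2 (is_lim_seq_unique _ _ H).
apply: (is_lim_seq_ext (fun M => PI ^ 2 / 6 - 2 * cosB M / cosA M)) => [M|].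
  by rewrite zeta2_partial.
rewrite -[X in is_lim_seq _ (Finite X)]Rminus_0_r.
apply: is_lim_seq_minus'; first exact: is_lim_seq_const.
apply/is_lim_seq_incr_1.
(* By [cosB_bound] and [cosA_rec] the remainder at [M.+1] is at most [2 / (2 M + 1)]. *)
apply: (is_lim_seq_le_le (fun=> 0) _ (fun M => 2 / INR M.+1)).
- move=> M; have [B0 B1] := cosB_bound M; have A0 := cosA_gt0 M.+1.
  have M0 := pos_INR M; have E1 := cosA_rec M; rewrite S_INR.
  split; first by apply: Rdiv_le_0_compat => //; lra.
  apply/Rle_div_l => //.
  apply: Rle_trans (_ : 2 * (cosA M - cosA M.+1) <= _); first lra.
  apply: (Rmult_le_reg_l ((INR M + 1) * (2 * INR M + 1))); first nra.
  rewrite (_ : _ * (2 / _ * _) = 2 * (2 * INR M + 1) * cosA M.+1); last by field; lra.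
  rewrite (_ : _ * (2 * _) = 2 * (INR M + 1) * ((2 * INR M + 1) * cosA M
     - (2 * INR M + 1) * cosA M.+1)); last by ring.
  rewrite -E1; nra.
- exact: is_lim_seq_const.
- exact/(is_lim_seq_incr_1 (fun n => 2 / INR n))/is_lim_seq_inv_INR.
Qed.

(** * The averages of [calM] *)

Definition alpha_loc (n : nat) : R := let p := INR n in
  (1 - p - 2 * p ^ 2 + p ^ 4) / (p ^ 4 - 2 * p ^ 2 + p).

Definition beta_loc (n : nat) : R := let p := INR n in
  (- 1 + p ^ 2 + p ^ 3) / (p * (- 1 + p + p ^ 2)).

Lemma alpha_den_gt0 (p : R) : 2 <= p -> 0 < p ^ 4 - 2 * p ^ 2 + p.
Proof.
move=> p2; have := gloc_den_gt0 p p2; have : 0 < p ^ 4 by apply: pow_lt; lra.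
lra.
Qed.

Lemma alpha_loc_bound (n : nat) : prime n ->
  Rabs (alpha_loc n - 1) <= 10 * (/ INR n - / INR n.+1).
Proof.
move=> /prime_gt1 n2; have p2 : 2 <= INR n by apply: (le_INR 2); lia.
rewrite inv_diff; last lia.
rewrite S_INR /alpha_loc; set p := INR n in p2 *.
have D0 := alpha_den_gt0 p p2; have den := gloc_den_gt0 p p2.
set D := _ + p in D0 *.
rewrite (_ : _ / D - 1 = - ((2 * p - 1) / D)); last first.
  by rewrite (_ : 1 - p - 2 * p ^ 2 + p ^ 4 = D - (2 * p - 1)); [field; lra|rewrite /D; ring].
rewrite Rabs_Ropp Rabs_right; last first.
  by apply: Rle_ge; apply: Rdiv_le_0_compat; lra.
apply/Rle_div_l => //.
rewrite (_ : 10 * / (p * (p + 1)) * D = 10 * D / (p * (p + 1))); last by field; lra.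
apply/Rle_div_r; first nra.
have p4 : 0 < p ^ 4 by apply: pow_lt; lra.
apply: Rle_trans (_ : 10 * (p ^ 4 * (7 / 16)) <= _); last by rewrite /D; lra.
have : 0 <= (p - 2) * p by nra.
have : 0 <= (p - 2) * (p * p * p) by nra.
have : 0 <= (p - 2) * (p * p) by nra.
nra.
Qed.

Lemma alpha_lim : exists a : R, alpha = 2 * PI * a /\
  is_lim_seq (fun N => \big[Rmult/1]_(0 <= p < N | prime p) alpha_loc p) a.
Proof.
have [a Ha] := prime_prod_cv (fun n => alpha_loc n - 1) alpha_loc_bound.
have {}Ha : is_lim_seq (fun N => \big[Rmult/1]_(0 <= p < N | prime p) alpha_loc p) a.
  by apply: is_lim_seq_ext Ha => N; apply: eq_bigr => p _; ring.
exists a; split=> //; rewrite /alpha /euler_product.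
by rewrite (is_lim_seq_unique _ _ Ha).
Qed.

(** True prime by prime: [beta_loc = alpha_loc * (1 + gloc)]. Thus the [beta] term of [calM] is
    precisely the linear term of [K]. *)
Lemma beta_alpha (G : R) : is_lim_seq Gfac G -> beta = alpha * G.
Proof.
move=> HG; have [a [-> Ha]] := alpha_lim.
have H : is_lim_seq (fun N => \big[Rmult/1]_(0 <= p < N | prime p) beta_loc p) (a * G).
  have := is_lim_seq_mult' _ _ _ _ Ha HG; apply: is_lim_seq_ext => N.
  rewrite /Gfac -big_split /=; apply: eq_bigr => n /prime_gt1 n2.
  have p2 : 2 <= INR n by apply: (le_INR 2); lia.
  rewrite /alpha_loc /beta_loc /gloc; set p := INR n in p2 *.
  have D0 := alpha_den_gt0 p p2; have den := gloc_den_gt0 p p2.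
  have p4 : 0 < p ^ 4 by apply: pow_lt; lra.
  have ? : 0 < - 1 + p + p ^ 2 by nra.
  by field; repeat split; lra.
by rewrite /beta /euler_product (is_lim_seq_unique _ _ H) /=; ring.
Qed.

(** Prime by prime, [alpha_loc] times the local factor of [Afac] is [1 - 1 / p^2]; the rest is the
    Euler product and [zeta2E]. *)
Lemma alpha_Afac (A : R) : is_lim_seq Afac A -> alpha * A = 12 / PI.
Proof.
move=> HA; have [a [-> Ha]] := alpha_lim; have pi0 := PI_RGT_0.
have H : is_lim_seq zeta2_inv_prod (a * A).
  have := is_lim_seq_mult' _ _ _ _ Ha HA; apply: is_lim_seq_ext => N.
  rewrite /Afac -big_split /=; apply: eq_bigr => n /prime_gt1 n2.
  have p2 : 2 <= INR n by apply: (le_INR 2); lia.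
  rewrite /alpha_loc /gloc; set p := INR n in p2 *.
  have D0 := alpha_den_gt0 p p2; have den := gloc_den_gt0 p p2.
  have p4 : 0 < p ^ 4 by apply: pow_lt; lra.
  by field; repeat split; lra.
have := is_lim_seq_unique _ _ euler_zeta2.
rewrite (is_lim_seq_unique _ _ (is_lim_seq_scal_l _ zeta2 (Finite _) H)) => -[].
rewrite zeta2E => E.
have -> : 2 * PI * a * A = PI ^ 2 / 6 * (a * A) * (12 / PI) by field; lra.
by rewrite E; ring.
Qed.

(** * [calM] as a derivative *)

Lemma is_derive_bigsum (F dF : nat -> R -> R) (n : nat) (x : R) :
  (forall i, (0 < i)%N -> is_derive (F i) x (dF i x)) ->
  is_derive (fun t => \big[Rplus/0]_(1 <= i < n.+1) F i t) x
    (\big[Rplus/0]_(1 <= i < n.+1) dF i x).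
Proof.
move=> H; elim: n => [|n IH].
  rewrite big_geq //; apply: (is_derive_ext (fun=> 0)) => [t|]; first by rewrite big_geq.
  exact: is_derive_const.
rewrite big_nat_recr //; apply: (is_derive_ext
  (fun t => \big[Rplus/0]_(1 <= i < n.+1) F i t + F n.+1 t)) => [t|].
  by rewrite [RHS]big_nat_recr.
by apply: is_derive_plus => //; apply: H.
Qed.

Lemma continuous_bigsum (F : nat -> R -> R) (n : nat) (x : R) :
  (forall i, (0 < i)%N -> continuous (F i) x) ->
  continuous (fun t => \big[Rplus/0]_(1 <= i < n.+1) F i t) x.
Proof.
move=> H; elim: n => [|n IH].
  by apply: (continuous_ext (fun=> 0)) => [t|]; [rewrite big_geq|apply: continuous_const].
apply: (continuous_ext
  (fun t => \big[Rplus/0]_(1 <= i < n.+1) F i t + F n.+1 t)) => [t|].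
  by rewrite [RHS]big_nat_recr.
by apply: (continuous_plus (fun t => bigop.body _ _ _)) => //; apply: H.
Qed.

Definition dKsum (j M : nat) (G Z : R) : R :=
  \big[Rplus/0]_(1 <= r < M.+1) (nu r * dkker j (Z / INR r))
  + G * (- 1) ^ j / (2 * INR j + 1) / 2.

Definition dK (j : nat) (G Z : R) : R := dKsum j (ceil_nat Z) G Z.

(** Allowing [Z < INR M1 + 1] instead of [Z <= INR M1] admits the cutoff of [calM], the integer part
    of [Z]. *)
Lemma dKsum_bound (j : nat) (M1 M2 : nat) (G Z : R) : (M1 <= M2)%N ->
  0 < Z < INR M1 + 1 -> dKsum j M1 G Z = dKsum j M2 G Z.
Proof.
move=> M12 H1; congr Rplus.
rewrite [RHS](big_cat_nat (n := M1.+1)) //= [X in _ + X]big_nat.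
rewrite [X in _ + X]big1 ?Rplus_0_r // => r Hr.
have Zr : INR M1 + 1 <= INR r by rewrite -S_INR; apply: le_INR; lia.
rewrite dkker_le1 ?Rmult_0_r //; split; first by apply: Rdiv_le_0_compat; lra.
by apply/Rle_div_l; lra.
Qed.

Lemma dKE (j M : nat) (G Z : R) : 0 < Z <= INR M -> dK j G Z = dKsum j M G Z.
Proof.
move=> ZM; have := ceil_natP Z (proj1 ZM); rewrite /dK => ZU.
have [H|/ltnW H] := leqP (ceil_nat Z) M; last symmetry; apply: dKsum_bound => //; lra.
Qed.

Lemma dK_near (j : nat) (G Z : R) : 0 < Z -> exists M, 0 < Z <= INR M /\
  (locally Z (fun z => dKsum j M G z = dK j G z)) /\
  locally Z (fun z => Sfun j nu M z + G * (- 1) ^ j / (2 * INR j + 1) * z / 2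
    = Kgen j nu G z).
Proof.
(* [ceil_nat] jumps at integers; a cutoff larger by one is valid on a whole neighbourhood of [Z]. *)
move=> Z0; have [_ ZM] := ceil_natP Z Z0; exists (ceil_nat Z).+1; rewrite S_INR.
have ZM1 : Z < INR (ceil_nat Z) + 1 by lra.
have near (P : R -> Prop) : (forall z, 0 < z <= INR (ceil_nat Z).+1 -> P z) -> locally Z P.
  move=> HP; apply: (locally_interval _ Z 0 (INR (ceil_nat Z) + 1) Z0 ZM1) => z z0 z1.
  by apply: HP; rewrite S_INR; split=> //; apply: Rlt_le; exact: z1.
split; first by lra.
by split; apply: near => z zb; [rewrite -dKE|rewrite -KgenE].
Qed.

Lemma continuous_div_const (Z c : R) : continuous (fun z => z / c) Z.
Proof.
by apply: (continuous_mult (fun z => z)); [exact: continuous_id|exact: continuous_const].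
Qed.

Lemma continuous_dK (j : nat) (G Z : R) : 0 < Z -> continuous (dK j G) Z.
Proof.
move=> Z0; have [M [ZM [H _]]] := dK_near j G Z Z0.
apply: (continuous_ext_loc _ (dKsum j M G)) => //.
apply: (continuous_plus (fun z => bigop.body _ _ _)); last exact: continuous_const.
apply: continuous_bigsum => r r0; apply: (continuous_mult (fun=> nu r)).
  exact: continuous_const.
apply: (continuous_comp (fun z => z / INR r) (dkker j)).
  exact: continuous_div_const.
exact: continuous_dkker.
Qed.

Lemma is_derive_Kgen (j : nat) (G Z : R) : 0 < Z ->
  is_derive (Kgen j nu G) Z (dK j G Z).
Proof.
move=> Z0; have [M [ZM [_ H]]] := dK_near j G Z Z0; rewrite (dKE j M) //.
have Hj := pos_INR j.
apply: (is_derive_ext_loc _ _ _ _ H); apply: is_derive_plus; last first.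
  by auto_derive => //; field; lra.
apply: (is_derive_bigsum (fun r z => nu r * (INR r * kker j (z / INR r)))
  (fun r z => nu r * dkker j (z / INR r))) => r r0.
have Hr := INR_gt0 r r0.
apply: is_derive_scal.
rewrite (_ : dkker _ _ = INR r * (/ INR r * dkker j (Z / INR r))); last by field; lra.
apply: is_derive_scal; apply: (is_derive_comp (kker j) (fun z => z / INR r)).
  by apply: is_derive_kker; apply: Rdiv_lt_0_compat.
by auto_derive => //; field; lra.
Qed.

Lemma sign_sqr (j : nat) : (- 1) ^ j * (- 1) ^ j = 1.
Proof. by rewrite -Rpow_mult_distr (_ : -1 * -1 = 1) ?pow1; lra. Qed.

Lemma calME (j : nat) (G y : R) : (0 < j)%N -> is_lim_seq Gfac G -> 0 < y ->
  calM (2 * j + 2) y = alpha * (- 1) ^ j * (2 * sqrt y * dK j G (2 * sqrt y)).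
Proof.
move=> j0 HG y0; have Hj := pos_INR j; rewrite /calM; case: (Rlt_dec 0 y) => [?|//].
have -> : ((2 * j + 2)./2 - 1 = j)%N by lia.
have -> : (2 * j + 2 - 2 = 2 * j)%N by lia.
have -> : (2 * j + 2 == 2)%N = false by apply/eqP; lia.
have -> : INR (2 * j + 2) = 2 * INR j + 2.
  by rewrite -plusE -multE plus_INR mult_INR.
have sy : 0 < sqrt y by apply: sqrt_lt_R0.
have syy : sqrt y * sqrt y = y by apply: sqrt_sqrt; lra.
set Z := 2 * sqrt y; have Z0 : 0 < Z by rewrite /Z; lra.
rewrite (beta_alpha G HG).
have [Zb1 Zb2] := base_Int_part Z.
have i0 : (0 <= Int_part Z)%Z.
  have : (-1 < Int_part Z)%Z by apply: lt_IZR; lra.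
  lia.
have -> : dK j G Z = dKsum j (Z.to_nat (Int_part Z)) G Z.
  rewrite /dK /ceil_nat; symmetry; apply: dKsum_bound => //.
  by rewrite INR_IZR_INZ Z2Nat.id //; lra.
set M := Z.to_nat _; rewrite /dKsum.
rewrite (eq_big_nat _ _ (F2 := fun r => Z * (2 * INR j + 1) * (nu r * dkker j (Z / INR r)))).
  rewrite -big_distrr /=; set S := bigop.body _ _ _.
  set e := (- 1) ^ j.
  (* The [beta] term of [calM] carries no sign: the sign in [K] meets the one in front and squares
     to [1]. *)
  have -> : alpha * e * (Z * (S + G * e / (2 * INR j + 1) / 2)) =
      alpha * e * Z * S + alpha * (e * e) * Z * G / (2 * INR j + 1) / 2 by field; lra.
  by rewrite sign_sqr /Z; field; lra.
move=> r /andP [r0 rM]; have Hr := INR_gt0 r r0.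
have rZ : INR r <= Z.
  apply: Rle_trans Zb1; rewrite -(Z2Nat.id (Int_part Z)) // -INR_IZR_INZ.
  by apply: le_INR; rewrite /M in rM; lia.
have z1 : 1 <= Z / INR r by apply/Rle_div_r; lra.
rewrite /dkker (_ : Z * _ * _ = nu r * (Z * sin ((2 * INR j + 1) * phi (Z / INR r))));
  last by field; lra.
rewrite Rmult_assoc; congr Rmult.
have E : sqrt (4 * y - INR r ^ 2) = Z * sin (phi (Z / INR r)).
  rewrite sin_phi //.
  have -> : Z * (sqrt ((Z / INR r) ^ 2 - 1) / (Z / INR r)) = INR r * sqrt ((Z / INR r) ^ 2 - 1).
    by field; lra.
  rewrite -{2}(sqrt_pow2 (INR r)); last lra.
  rewrite -sqrt_mult_alt; last by nra.
  by congr sqrt; rewrite -[in LHS]syy /Z; field; lra.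
have [s0|s0] := Req_dec (sin (phi (Z / INR r))) 0.
  have [p0 p1] := phi_bound (Z / INR r); have pi0 := PI_RGT_0.
  have ph : phi (Z / INR r) = 0.
    have [pp|//] := p0.
    by have := sin_gt_0 (phi (Z / INR r)) pp ltac:(lra); lra.
  by rewrite E ph Rmult_0_r sin_0; ring.
rewrite E (_ : INR r / Z = cos (phi (Z / INR r))); last by rewrite cos_phi //; field; lra.
rewrite chebyshevU_cos // -multE mult_INR (_ : INR 2 = 2) //; field; lra.
Qed.

Lemma continuous_calM (j : nat) (y : R) : (0 < j)%N -> 0 < y ->
  continuous (calM (2 * j + 2)) y.
Proof.
move=> j0 y0; have [G HG] := Gfac_cv.
apply: (continuous_ext_loc _ (fun y =>
  alpha * (- 1) ^ j * (2 * sqrt y * dK j G (2 * sqrt y)))).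
  apply: (locally_interval _ y 0 p_infty) => // z z0 _.
  by rewrite (calME j G).
have c2 : continuous (fun y => 2 * sqrt y) y.
  apply: (continuous_mult (fun=> 2)); first exact: continuous_const.
  exact: continuous_sqrt.
apply: (continuous_mult (fun=> _)); first exact: continuous_const.
apply: (continuous_mult (fun y => 2 * sqrt y)) => //.
apply: (continuous_comp (fun y => 2 * sqrt y) (dK j G)) => //.
by apply: continuous_dK; have := sqrt_lt_R0 y y0; lra.
Qed.

Lemma RInt_weight (c : R) : 1 < c -> RInt (fun u => u ^ 2 / u) 1 c = (c ^ 2 - 1) / 2.
Proof.
move=> c1; apply: is_RInt_unique.
apply: (is_RInt_ext (fun u => u)) => [u|].
  by rewrite Rmin_left ?Rmax_right; try lra; move=> ub; eqR; field; lra.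
rewrite (_ : (c ^ 2 - 1) / 2 = c ^ 2 / 2 - 1 ^ 2 / 2); last by field.
apply: (is_RInt_antiderivative (fun u => u ^ 2 / 2)) => u; last exact: continuous_id.
by auto_derive => //; field.
Qed.

(** The substitution [v = y / u] moves [y] out of the integrand: the numerator becomes
    [y ^ 2 * (P y - P (y / c))] with [P] a primitive of [calM v / v ^ 3]. *)
Lemma calM_avg_continuous (j : nat) (c y : R) : (0 < j)%N -> 1 < c -> 0 < y ->
  continuous (calM_avg c (2 * j + 2)) y.
Proof.
move=> j0 c1 y0; set k := (2 * j + 2)%N.
pose f v := calM k v / v ^ 3.
have cf v : 0 < v -> continuous f v.
  move=> v0; apply: (continuous_mult (calM k) (fun v => / v ^ 3)).
    exact: continuous_calM.
  by apply: continuous_ex_derive; auto_derive; apply: Rgt_not_eq; apply: (pow_lt v 3).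
pose P v := RInt f 1 v.
have exf a b : 0 < a -> 0 < b -> ex_RInt f a b.
  move=> a0 b0; apply: ex_RInt_continuous => z [za _]; apply: cf.
  by apply: Rlt_le_trans za; apply: Rmin_pos.
have dP v : 0 < v -> continuous P v.
  move=> v0; apply: continuous_ex_derive; exists (f v).
  apply: (is_derive_RInt f _ 1); last exact: cf.
  apply: (locally_interval _ v 0 p_infty) => // b b0 _.
  by apply: RInt_correct; apply: exf => //; lra.
have sub x : 0 < x -> RInt (fun u => calM k (x / u) * u ^ 2 / u) 1 c =
    x ^ 2 * (P x - P (x / c)).
  move=> x0.
  have I := is_RInt_comp f (fun u => x / u) (fun u => - x / u ^ 2) 1 c.
  have {}I := is_RInt_scal _ _ _ (- x ^ 2) _ (I _ _).
  apply: is_RInt_unique.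
  have -> : x ^ 2 * (P x - P (x / c)) = scal (- x ^ 2) (RInt f (x / 1) (x / c)).
    have -> : x / 1 = x by field.
    have := RInt_Chasles f 1 x (x / c); rewrite -/(P x) -/(P (x / c)) => Ch.
    have xc : 0 < x / c by apply: Rdiv_lt_0_compat; lra.
    have := Ch (exf _ _ Rlt_0_1 x0) (exf _ _ x0 xc); rewrite /plus /= => <-.
    by rewrite /scal /= /mult /=; ring.
  apply: is_RInt_ext (I _ _).
  - rewrite Rmin_left ?Rmax_right; try lra; move=> u ub.
    rewrite /scal /= /mult /= /f; eqR; field; lra.
  - rewrite Rmin_left ?Rmax_right; try lra; move=> u ub.
    by apply: cf; apply: Rdiv_lt_0_compat; lra.
  - rewrite Rmin_left ?Rmax_right; try lra; move=> u ub; split.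
      by auto_derive; [lra|field; lra].
    by apply: continuous_ex_derive; auto_derive; nra.
apply: (continuous_ext_loc _
  (fun x => x ^ 2 * (P x - P (x / c)) * / ((c ^ 2 - 1) / 2))).
  apply: (locally_interval _ y 0 p_infty) => // z z0 _.
  by rewrite /calM_avg RInt_weight // sub.
apply: (continuous_mult (fun x => x ^ 2 * (P x - P (x / c)))); last exact: continuous_const.
apply: (continuous_mult (fun x => x ^ 2)).
  by apply: continuous_ex_derive; auto_derive.
apply: (continuous_minus P (fun x => P (x / c))); first exact: dP.
apply: (continuous_comp (fun x => x / c) P); first exact: continuous_div_const.
by apply: dP; apply: Rdiv_lt_0_compat; lra.
Qed.

Lemma calM_avg_0 (c : R) (k : nat) : calM_avg c k 0 = 0.
Proof.
rewrite /calM_avg (_ : RInt _ 1 c = 0); first by rewrite /Rdiv Rmult_0_l.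
rewrite (RInt_ext _ (fun=> 0)) => [|u _].
  by rewrite RInt_const /scal /= /mult /= Rmult_0_r.
rewrite /calM /Rdiv Rmult_0_l; case: (Rlt_dec 0 0) => [|?]; first by move=> H; exfalso; lra.
by rewrite !Rmult_0_l.
Qed.

(* Integration by parts, using [calM (y / u) = - 2 alpha (-1)^j u L'(u)]
   for [L u = K (2 sqrt (y / u))]. *)
Lemma calM_avg_parts (j : nat) (G c y : R) : (0 < j)%N -> is_lim_seq Gfac G ->
  1 < c -> 0 < y ->
  let L u := Kgen j nu G (2 * sqrt (y / u)) in
  ex_RInt (fun u => u * (L u - L c)) 1 c /\
  calM_avg c (2 * j + 2) y =
   (2 * (alpha * (- 1) ^ j) * (L 1 - L c)
    + 4 * (alpha * (- 1) ^ j) * RInt (fun u => u * (L u - L c)) 1 c) / ((c ^ 2 - 1) / 2).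
Proof.
move=> j0 HG c1 y0 L; set a := alpha * (- 1) ^ j.
pose dL u := - (sqrt (y / u) / u) * dK j G (2 * sqrt (y / u)).
have DL u : 0 < u -> is_derive L u (dL u).
  move=> u0; have yu : 0 < y / u by apply: Rdiv_lt_0_compat.
  have s0 := sqrt_lt_R0 _ yu.
  apply: (is_derive_comp (Kgen j nu G) (fun u => 2 * sqrt (y / u))).
    by apply: is_derive_Kgen; lra.
  auto_derive; first by split=> //; lra.
  have ss : sqrt (y / u) * sqrt (y / u) = y / u by apply: sqrt_sqrt; lra.
  rewrite -/(Rdiv y u).
  have -> : y = sqrt (y / u) * sqrt (y / u) * u by rewrite ss; field; lra.
  rewrite (_ : sqrt (y / u) * sqrt (y / u) * u / u = y / u); last by rewrite ss; field; lra.
  by field; lra.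
have cL u : 0 < u -> continuous (fun u => u * (L u - L c)) u.
  move=> u0; apply: (continuous_mult (fun u => u)); first exact: continuous_id.
  apply: (continuous_minus L); last exact: continuous_const.
  by apply: continuous_ex_derive; exists (dL u); apply: DL.
have ex1 : ex_RInt (fun u => u * (L u - L c)) 1 c.
  apply: ex_RInt_continuous => u; rewrite Rmin_left ?Rmax_right; try lra.
  by move=> ub; apply: cL; lra.
split=> //; rewrite /calM_avg RInt_weight //; congr Rdiv.
apply: is_RInt_unique.
have cM u : 0 < u -> continuous (fun u => u * calM (2 * j + 2) (y / u)) u.
  move=> u0; apply: (continuous_mult (fun u => u)); first exact: continuous_id.
  apply: (continuous_comp (fun u => y / u)).
    by apply: continuous_ex_derive; auto_derive; lra.
  by apply: continuous_calM => //; apply: Rdiv_lt_0_compat.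
(* Normalising the primitive by [L c] kills the boundary term at [c] and leaves only differences of
   [K] under the dilations [sqrt (c / u)]. *)
have IT : is_RInt (fun u => u * calM (2 * j + 2) (y / u) - 4 * a * (u * (L u - L c))) 1 c
    (- (2 * a) * (c ^ 2 * (L c - L c)) - (- (2 * a) * (1 ^ 2 * (L 1 - L c)))).
  apply: (is_RInt_derive (fun u => - (2 * a) * (u ^ 2 * (L u - L c))));
    rewrite Rmin_left ?Rmax_right; try lra; move=> u ub; have u0 : 0 < u by lra.
    rewrite (calME j G) //; last by apply: Rdiv_lt_0_compat.
    have D := DL u u0.
    auto_derive; first by exists (dL u).
    rewrite (is_derive_unique (fun x => L x) _ _ D) /dL -/a.
    by field; lra.
  apply: (continuous_minus (fun u => u * calM (2 * j + 2) (y / u))); first exact: cM.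
  apply: (continuous_mult (fun=> 4 * a)); first exact: continuous_const.
  exact: cL.
have := is_RInt_plus _ _ _ _ _ _ IT (is_RInt_scal _ _ _ (4 * a) _ (RInt_correct _ _ _ ex1)).
rewrite (_ : plus _ _ = 2 * a * (L 1 - L c) + 4 * a * RInt (fun u => u * (L u - L c)) 1 c);
  last by rewrite /plus /scal /= /mult /=; eqR; ring.
apply: is_RInt_ext; rewrite Rmin_left ?Rmax_right; try lra; move=> u ub.
by rewrite /plus /scal /= /mult /=; eqR; field; lra.
Qed.

(** The integral of [u * (L u - L c)] for a function of unit logarithmic slope; the [/ 2] comes from
    the square root in the dilation. *)
Lemma is_RInt_log_weight (c : R) : 1 < c ->
  is_RInt (fun u => u * (ln (c / u) / 2)) 1 c ((c ^ 2 - 1) / 8 - ln c / 4).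
Proof.
move=> c1; pose F u := u ^ 2 * ln (c / u) / 4 + u ^ 2 / 8.
rewrite (_ : _ - _ = F c - F 1); last first.
  rewrite /F (_ : c / c = 1); last by field; lra.
  by rewrite ln_1 (_ : c / 1 = c); field.
apply: (is_RInt_derive F); rewrite Rmin_left ?Rmax_right; try lra; move=> u ub.
  have cu : 0 < c / u by apply: Rdiv_lt_0_compat; lra.
  rewrite /F; auto_derive; first by split; [lra|].
  by rewrite -/(Rdiv c u); field; lra.
apply: continuous_ex_derive; auto_derive; split; first lra.
by split=> //; apply: Rdiv_lt_0_compat; lra.
Qed.

Lemma calM_avg_lim (j : nat) (c : R) : (0 < j)%N -> 1 < c ->
  is_lim (calM_avg c (2 * j + 2)) p_infty (1 / 2).
Proof.
move=> j0 c1; have [G HG] := Gfac_cv; have [A HA] := Afac_cv.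
set a := alpha * (- 1) ^ j; pose S := A * slope j.
have aS : a * S = 1 / 2.
  have -> : a * S = (alpha * A) * ((- 1) ^ j * (- 1) ^ j) * (PI / 24).
    by rewrite /a /S /slope; field.
  by rewrite alpha_Afac // sign_sqr; field; have := PI_RGT_0; lra.
have c0 : 0 < c ^ 2 - 1 by nra.
pose W := 2 * Rabs a + 4 * Rabs a * (c * (c - 1)).
have Ha := Rabs_pos a.
have W0 : 0 <= W by rewrite /W; have : 0 <= Rabs a * (c * (c - 1)); [apply: Rmult_le_pos|]; nra.
apply/is_lim_spec => eps.
have e0 := cond_pos eps.
(* An error [e] in each difference of [K] costs at most [W * e] in the numerator. *)
pose e := pos eps * ((c ^ 2 - 1) / 2) / (W + 1).
have ep : 0 < e by apply: Rdiv_lt_0_compat; nra.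
have sc1 : 1 <= sqrt c by rewrite -sqrt_1; apply: sqrt_le_1_alt; lra.
have [Z0 [Z00 HZ]] := Kgen_slope j G A (sqrt c) e j0 sc1 ep HG HA.
exists (c * Z0 ^ 2) => y yZ.
have y0 : 0 < y by apply: Rle_lt_trans yZ; apply: Rmult_le_pos; nra.
pose L u := Kgen j nu G (2 * sqrt (y / u)).
have [exL ->] : ex_RInt (fun u => u * (L u - L c)) 1 c /\
  calM_avg c (2 * j + 2) y = (2 * a * (L 1 - L c)
    + 4 * a * RInt (fun u => u * (L u - L c)) 1 c) / ((c ^ 2 - 1) / 2).
  exact: calM_avg_parts.
have yc : 0 < y / c by apply: Rdiv_lt_0_compat; lra.
have HL u : 1 <= u <= c -> Rabs (L u - L c - S * (ln (c / u) / 2)) <= e.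
  move=> ub; have cu : 1 <= c / u by apply/Rle_div_r; lra.
  have scu : 1 <= sqrt (c / u) <= sqrt c.
    split; first by rewrite -sqrt_1; apply: sqrt_le_1_alt.
    by apply: sqrt_le_1_alt; apply/Rle_div_l; nra.
  have Zc : Z0 <= 2 * sqrt (y / c).
    have : Z0 <= sqrt (y / c).
      rewrite -(sqrt_pow2 Z0); last lra.
      by apply: sqrt_le_1_alt; apply/(Rle_div_r (Z0 ^ 2) y c); lra.
    have := sqrt_pos (y / c); lra.
  have := HZ _ _ Zc scu.
  have -> : sqrt (c / u) * (2 * sqrt (y / c)) = 2 * sqrt (y / u).
    rewrite (_ : y / u = (c / u) * (y / c)); last by field; lra.
    by rewrite sqrt_mult; [ring|lra|lra].
  have -> : ln (sqrt (c / u)) = ln (c / u) / 2.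
    rewrite -{2}(sqrt_sqrt (c / u)); last lra.
    by rewrite ln_mult; [field|lra|lra].
  by [].
have H1 := HL 1 ltac:(lra); rewrite (_ : c / 1 = c) in H1; last by field.
set I := RInt _ _ _.
have H2 : Rabs (I - S * ((c ^ 2 - 1) / 8 - ln c / 4)) <= e * (c * (c - 1)).
  have IL := is_RInt_scal _ _ _ S _ (is_RInt_log_weight c c1).
  have ID := is_RInt_minus _ _ _ _ _ _ (RInt_correct _ _ _ exL) IL.
  rewrite -[_ - _]/(minus I (scal S ((c ^ 2 - 1) / 8 - ln c / 4))).
  rewrite -(is_RInt_unique _ _ _ _ ID).
  apply: Rle_trans (_ : (c - 1) * (c * e) <= _); last by right; ring.
  apply: abs_RInt_le_const; [lra|by eexists; exact: ID|move=> u ub].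
  rewrite /minus /plus /opp /scal /= /mult /=.
  rewrite (_ : _ + _ = u * (L u - L c - S * (ln (c / u) / 2))); last by ring.
  rewrite Rabs_mult (Rabs_right u); last lra.
  by apply: Rmult_le_compat; [lra|exact: Rabs_pos|lra|exact: HL].
set d1 := L 1 - L c - _ in H1; set d2 := I - _ in H2.
(* In the main terms [ln c] cancels between the boundary term and the integral. What remains is
   [a * S * (c ^ 2 - 1) / 2], hence the limit [a * S = 1 / 2]. *)
rewrite (_ : _ / _ - _ = (2 * a * d1 + 4 * a * d2) / ((c ^ 2 - 1) / 2)); last first.
  rewrite /d1 /d2 -aS; field; lra.
rewrite /Rdiv Rabs_mult Rabs_inv (Rabs_right (_ * / 2)); last lra.
apply/(Rlt_div_l (Rabs _)); first lra.
apply: Rle_lt_trans (_ : W * e < _).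
  apply: Rle_trans (Rabs_triang _ _) _; rewrite (Rabs_mult (2 * a)) (Rabs_mult (4 * a)).
  rewrite (Rabs_mult 2 a) (Rabs_mult 4 a) (Rabs_right 2) ?(Rabs_right 4); try lra.
  have : Rabs a * Rabs d1 <= Rabs a * e by apply: Rmult_le_compat_l.
  have : Rabs a * Rabs d2 <= Rabs a * (e * (c * (c - 1))) by apply: Rmult_le_compat_l.
  rewrite /W; lra.
have E : e * (W + 1) = pos eps * ((c ^ 2 - 1) / 2) by rewrite /e; field; lra.
lra.
Qed.

Theorem theorem6 (RH : RiemannHypothesis) (c : R) (hc : 1 < c)
    (k : nat) (hk : (6 <= k)%N) (keven : ~~ odd k) :
  (forall y : R, 0 < y -> continuous (calM_avg c k) y)
  /\ calM_avg c k 0 = 0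
  /\ is_lim (calM_avg c k) p_infty (Finite (1 / 2)).
Proof.
have [j j0 ->] : exists2 j, (0 < j)%N & k = (2 * j + 2)%N.
  by exists (k./2 - 1)%N; move: (even_halfK keven); lia.
split; first by move=> y; apply: calM_avg_continuous.
by split; [apply: calM_avg_0|apply: calM_avg_lim].
Qed.
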